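(* Let $\beta>0$ and $\alpha\in\mathbb{R}$ satisfy $|\alpha|\le\beta$, $\alpha<\beta$, $\alpha\neq 0$ and $|\alpha|+\beta=2$. For every even $N$ and every $S\subset\{1,\dots,N\}$ with $|S|=N/2$, let $\mu_{N,\alpha,\beta,S}$ be the block spin Ising Gibbs measure described in the context, and suppose one observes $n$ independent samples $\sigma^{(1)},\dots,\sigma^{(n)}$ drawn from $\mu_{N,\alpha,\beta,S}$, where $S$ is unknown. Then: \begin{itemize} \item If $\alpha>0$, there exists a positive constant $C_3$ such that there is an algorithm which, from the observations, recovers the block structure $(S,S^c)$ (i.e. the unordered partition $\{S,S^c\}$) exactly with probability at least $1-\delta$ whenever $n\ge C_3\, N\log(N/\delta)$. \item If $\alpha<0$, there exists a positive constant $C_4$ such that there is an algorithm which, from the observations, recovers the block structure $(S,S^c)$ exactly with probability at least $1-\delta$ whenever $n\ge C_4\, \sqrt{N}\log(N/\delta)$. \end{itemize}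
   Context: Block spin Ising model: let $N$ be even and $S\subset\{1,\dots,N\}$ with $|S|=N/2$. For $i,j\in\{1,\dots,N\}$ write $i\sim j$ if $i,j\in S$ or $i,j\in S^c$, and $i\not\sim j$ otherwise. For parameters $\beta>0$, $|\alpha|\le\beta$, the Hamiltonian on $\{-1,+1\}^N$ is $$H_{N,\alpha,\beta,S}(\sigma)=-\frac{\beta}{2N}\sum_{i\sim j}\sigma_i\sigma_j-\frac{\alpha}{2N}\sum_{i\not\sim j}\sigma_i\sigma_j,$$ where the sums run over ordered pairs $(i,j)$, and the Gibbs measure is $\mu_{N,\alpha,\beta,S}(\sigma)=e^{-H_{N,\alpha,\beta,S}(\sigma)}/\sum_{\sigma'}e^{-H_{N,\alpha,\beta,S}(\sigma')}$. An algorithm here is any procedure taking the $n$ observed configurations as input and outputting a partition of $\{1,\dots,N\}$ into two sets of size $N/2$; exact recovery means the output equals $\{S,S^c\}$. The constants $C_3,C_4$ may depend on $\alpha$ and $\beta$ but not on $N$, $n$ or $\delta$. *)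

(* Defs.v *)
From HB Require Import structures.
From mathcomp Require Import all_boot all_order all_algebra.
From mathcomp Require Import all_classical all_reals all_analysis.
Set Implicit Arguments. Unset Strict Implicit. Unset Printing Implicit Defensive.
Import Order.TTheory GRing.Theory Num.Theory.
Local Open Scope ring_scope.

Definition config (N : nat) := {ffun 'I_N -> bool}.

Definition spin {R : realType} (b : bool) : R := if b then 1 else -1.

Definition same_block (N : nat) (S : {set 'I_N}) (i j : 'I_N) : bool :=
  (i \in S) == (j \in S).

Definition hamiltonian {R : realType} (N : nat) (alpha beta : R)
  (S : {set 'I_N}) (s : config N) : R :=
  - (beta / (2 * N%:R)) *
      (\sum_(p : 'I_N * 'I_N | same_block S p.1 p.2) spin (s p.1) * spin (s p.2))
  - (alpha / (2 * N%:R)) *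
      (\sum_(p : 'I_N * 'I_N | ~~ same_block S p.1 p.2) spin (s p.1) * spin (s p.2)).

Definition gibbs {R : realType} (N : nat) (alpha beta : R)
  (S : {set 'I_N}) (s : config N) : R :=
  expR (- hamiltonian alpha beta S s) /
  \sum_(s' : config N) expR (- hamiltonian alpha beta S s').

Definition samples (N n : nat) := {ffun 'I_n -> config N}.

Definition sample_prob {R : realType} (N n : nat) (alpha beta : R)
  (S : {set 'I_N}) (E : pred (samples N n)) : R :=
  \sum_(x : samples N n | E x) \prod_(k < n) gibbs alpha beta S (x k).

(* An algorithm: for every N and n, a map from the n observed configurations
   to a set A, interpreted as the partition {A, A^c}. *)
Definition algorithm := forall N n : nat, samples N n -> {set 'I_N}.

Definition valid_algorithm (alg : algorithm) : Prop :=
  forall N n (x : samples N n), ~~ odd N -> #|alg N n x| = N./2.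

Definition exact_recovery (N : nat) (S A : {set 'I_N}) : bool :=
  (A == S) || (A == ~: S).

Definition recovers_with {R : realType} (alpha beta : R) (alg : algorithm)
  (C : R) (f : nat -> R) : Prop :=
  forall (N : nat) (S : {set 'I_N}) (n : nat) (delta : R),
    ~~ odd N -> #|S| = N./2 -> 0 < delta ->
    C * f N * ln (N%:R / delta) <= n%:R ->
    1 - delta <= sample_prob alpha beta S
                   (fun x => exact_recovery S (alg N n x)).

(* Main.v *)
Require Import Defs.
From HB Require Import structures.
From mathcomp Require Import all_boot all_order all_algebra.
From mathcomp Require Import all_classical all_reals all_analysis.
From mathcomp Require Import ring lra zify.
Import Order.TTheory GRing.Theory Num.Theory.
Import numFieldNormedType.Exports.
Local Open Scope ring_scope.

(** Write [u] for the total magnetization, [v] for the magnetization of [S]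
minus that of its complement; then [-H = (kp u^2 + kq v^2) / (2N)] with
[kp = (alpha + beta) / 2] and [kq = (beta - alpha) / 2].  The algorithm
maximizes [sum_k v_A(x_k)^2] over balanced sets [A].  If [B] is the symmetric
difference of [A] and [S] (or its complement), [w] the part of [v] carried by
[B] and [r = v - w], then [v_A^2 - v^2 = - 4 w r], so a failure at [A] forces
[sum_k w r <= 0].

Pairing each site of [S] with a site of its complement, inside or outside [B],
all Gibbs weights at hand are exponentials of polynomials with nonnegative
coefficients in the sums and differences of paired spins, for which Griffiths'
first inequality holds.  It yields [E (w r) >= c |B| / N * E v^2] under the Gibbs
measure tilted by [X = t v^2 - kq w r / (2N)], [t] being of order [|B| / N^2], and
[e^X <= 1 + X e^X] turns this into [E e^X <= 1] under the Gibbs measure.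
Chernoff's bound and a union bound over [B] then leave only the event that
[sum_k v^2] is smaller than [c n V], for [V = N] if [alpha > 0] and
[V = N sqrt N] if [alpha < 0].  By the same convexity argument its probability
is exponentially small in [n] once [E v^2 >= c V] at a slightly smaller
[kq].  For [alpha > 0] this is the diagonal contribution; for [alpha < 0] it
comes from the identities [E (phi y_i) = E (phi tanh h_i)] for a spin [y_i] in
its local field [h_i], applied at [kq = 1 - 1 / sqrt N]. *)

Set Implicit Arguments. Unset Strict Implicit. Unset Printing Implicit Defensive.

(** * Griffiths' first inequality through a cone of functions *)

Section GriffithsCone.
Variables (R : realType) (X : finType) (J : eqType).
Variables (g : J -> X -> R) (tau : J -> X -> X).
Hypothesis tau_inj : forall j, injective (tau j).
Hypothesis g_tau : forall j x, g j (tau j x) = - g j x.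
Hypothesis g_tau_neq : forall j k x, k != j -> g k (tau j x) = g k x.

(** If some generator occurs to an odd power, the bijection [tau j] negates that power and fixes all
    other factors, so the sum is its own negative. Otherwise every term is a product of even
    powers. *)
Lemma sum_monomial_ge0 (l : seq J) : 0 <= \sum_x \prod_(j <- l) g j x.
Proof.
have expE x : \prod_(j <- l) g j x = \prod_(j <- undup l) g j x ^+ count_mem j l.
  by rewrite prodr_undup_exp_count.
case: (boolP (has (fun j => odd (count_mem j l)) l)) => [/hasP[j jl oddj]|].
  suff /eqP : \sum_x \prod_(k <- l) g k x = - \sum_x \prod_(k <- l) g k x.
    by rewrite -addr_eq0 -mulr2n mulrn_eq0 /= => /eqP ->.
  rewrite {1}(reindex_inj (@tau_inj j)) /= -sumrN; apply: eq_bigr => x _.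
  rewrite !expE (bigD1_seq j) ?mem_undup ?undup_uniq //=.
  rewrite (bigD1_seq j) ?mem_undup ?undup_uniq //= -mulNr; congr (_ * _).
    by rewrite g_tau exprNn -signr_odd oddj expr1 mulN1r.
  by apply: eq_bigr => k kj; rewrite g_tau_neq.
move=> /hasPn ev; apply: sumr_ge0 => x _; rewrite expE big_seq.
apply: prodr_ge0 => j; rewrite mem_undup => /ev evj.
by rewrite exprn_even_ge0.
Qed.

Definition monomially_pos (h : X -> R) :=
  forall l : seq J, 0 <= \sum_x h x * \prod_(j <- l) g j x.

(* Defining the cone by what it multiplies, rather than by its expansions into
   monomials, makes its closure under products immediate. *)
Definition gcone (f : X -> R) :=
  forall h, monomially_pos h -> monomially_pos (fun x => f x * h x).

Lemma gcone_sum_ge0 f : gcone f -> 0 <= \sum_x f x.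
Proof.
move=> Pf.
have P1 : monomially_pos (fun=> 1).
  by move=> l; under eq_bigr do rewrite mul1r; exact: sum_monomial_ge0.
have := Pf _ P1 [::]; under eq_bigr do rewrite big_nil !mulr1; by [].
Qed.

Lemma eq_gcone f f' : f =1 f' -> gcone f -> gcone f'.
Proof.
by move=> ff' Pf h /Pf Ph l; under eq_bigr do rewrite -ff'; exact: Ph.
Qed.

Lemma gcone_cst (c : R) : 0 <= c -> gcone (fun=> c).
Proof.
move=> c0 h Ph l; under eq_bigr do rewrite -mulrA.
by rewrite -mulr_sumr mulr_ge0.
Qed.

Lemma gcone_gen j : gcone (g j).
Proof.
move=> h Ph l; have := Ph (j :: l).
by under eq_bigr do rewrite big_cons mulrCA mulrA.
Qed.

Lemma gconeD f1 f2 : gcone f1 -> gcone f2 -> gcone (fun x => f1 x + f2 x).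
Proof.
move=> P1 P2 h Ph l; under eq_bigr do rewrite !mulrDl.
by rewrite big_split /= addr_ge0 ?P1 ?P2.
Qed.

Lemma gconeM f1 f2 : gcone f1 -> gcone f2 -> gcone (fun x => f1 x * f2 x).
Proof.
move=> P1 P2 h Ph l; under eq_bigr do rewrite -(mulrA (f1 _)).
exact: (P1 _ (P2 _ Ph)).
Qed.

Lemma gconeZ (c : R) f : 0 <= c -> gcone f -> gcone (fun x => c * f x).
Proof. by move=> c0 Pf; apply: gconeM => //; exact: gcone_cst. Qed.

Lemma gcone_sum (I : Type) (r : seq I) (Q : pred I) (F : I -> X -> R) :
  (forall i, Q i -> gcone (F i)) -> gcone (fun x => \sum_(i <- r | Q i) F i x).
Proof.
move=> PF; elim: r => [|i r IH].
  by apply: (@eq_gcone (fun=> 0)) => [x|]; rewrite ?big_nil //; exact: gcone_cst.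
case Qi: (Q i).
  apply: (@eq_gcone (fun x => F i x + \sum_(i <- r | Q i) F i x)) => [x|].
    by rewrite big_cons Qi.
  by apply: gconeD => //; exact: PF.
by apply: eq_gcone IH => x; rewrite big_cons Qi.
Qed.

Lemma gconeX f n : gcone f -> gcone (fun x => f x ^+ n).
Proof.
move=> Pf; elim: n => [|n IH].
  by apply: (@eq_gcone (fun=> 1)) => [x|]; rewrite ?expr0 //; exact: gcone_cst.
by apply: (@eq_gcone (fun x => f x * f x ^+ n)) => [x|];
  [rewrite exprS | exact: gconeM].
Qed.

(** Sums over [X] are finite, so each inequality defining the cone passes to pointwise limits. This
    brings exponentials into the cone. *)
Lemma gcone_lim (F : nat -> X -> R) f :
  (forall n, gcone (F n)) -> (forall x, F n x @[n --> \oo] --> f x)%classic ->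
  gcone f.
Proof.
move=> PF Ff h Ph l.
have cv : (\sum_x F n x * h x * \prod_(j <- l) g j x @[n --> \oo] -->
          \sum_x f x * h x * \prod_(j <- l) g j x)%classic.
  apply: cvg_big => [x|]; first exact: add_continuous.
  by move=> x _; apply: cvgMl; apply: cvgMl; exact: Ff.
by apply: (cvgr_to_ge cv); apply: nearW => n; exact: PF.
Qed.

(** The power series of [e^y] and of [e^y - y] both have nonnegative coefficients; the boolean [b]
    treats the two at once. *)
Lemma gcone_expR_sub f (b : bool) :
  gcone f -> gcone (fun x => expR (f x) - b%:R * f x).
Proof.
move=> Pf.
(* The exponential coefficients, the linear one erased when [b] holds. Partial sums below have
   [n.+2] terms so that the linear term is always among them. *)
pose a (k : nat) : R := (~~ (b && (k == 1%N)))%:R / k`!%:R.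
have ser n x : series (fun k => a k * f x ^+ k) n.+2
    = series (exp_coeff (f x)) n.+2 - b%:R * f x.
  have a0 : a 0 = 1 by rewrite /a andbF fact0 divr1.
  have a1 : a 1 = (~~ b)%:R by rewrite /a andbT factS fact0 divr1.
  have a2 k : a k.+2 = (k.+2`!%:R)^-1 by rewrite /a andbF mul1r.
  rewrite /series /= !(big_nat_recl _ _ _ (leq0n _)) /= a0 a1 !exp_coeffE.
  rewrite !factS !fact0 !expr0 !expr1 !muln1 invr1.
  under eq_bigr do rewrite a2.
  by case: b {a a0 a1 a2} => /=; ring.
apply: (@gcone_lim (fun n x => series (fun k => a k * f x ^+ k) n.+2)).
  move=> n; rewrite /series /=; apply: gcone_sum => k _.
  apply: gconeZ; last exact: gconeX.
  by rewrite divr_ge0.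
move=> x; under eq_fun do rewrite ser.
apply: cvgB; last exact: cvg_cst.
have := @is_cvg_series_exp_coeff R (f x).
rewrite -(cvg_shiftn 2) /=.
by under eq_fun do rewrite addn2.
Qed.

Lemma gcone_expR f : gcone f -> gcone (fun x => expR (f x)).
Proof.
move=> /(@gcone_expR_sub _ false); apply: eq_gcone => x.
by rewrite mul0r subr0.
Qed.

Lemma gcone_expR_subr f : gcone f -> gcone (fun x => expR (f x) - f x).
Proof.
move=> /(@gcone_expR_sub _ true); apply: eq_gcone => x.
by rewrite mul1r.
Qed.

End GriffithsCone.

(** * Pairing the sites of the two blocks *)

Lemma equicard_bij (T : finType) (A B : {set T}) :
  #|A| = #|B| -> exists2 f : T -> T, {in A &, injective f} & f @: A = B.
Proof.
move=> AB; exists (fun x => nth x (enum B) (index x (enum A))).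
  move=> x y xA yA; have ltB z : z \in A -> (index z (enum A) < size (enum B))%N.
    by rewrite -cardE -AB cardE index_mem mem_enum.
  rewrite (set_nth_default x y) ?ltB // => /eqP.
  rewrite nth_uniq ?ltB ?enum_uniq // => /eqP.
  by apply: (index_inj x); rewrite mem_enum.
apply/setP => y; apply/imsetP/idP => [[x xA ->]|yB].
  by rewrite -mem_enum mem_nth // -cardE -AB cardE index_mem mem_enum.
have yA : (index y (enum B) < size (enum A))%N.
  by rewrite -cardE AB cardE index_mem mem_enum.
exists (nth y (enum A) (index y (enum B))).
  by rewrite -mem_enum mem_nth.
by rewrite index_uniq ?enum_uniq // nth_index ?mem_enum // (set_nth_default y) //
  -cardE -AB cardE.
Qed.

(** Bijections inside and outside [B] are glued. On [S] the glued map preserves membership in [B],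
    which keeps it injective across the two pieces. *)
Lemma block_pairing (T : finType) (S B : {set T}) :
  #|S| = #|~: S| -> #|B :&: S| = #|B :\: S| ->
  exists f : T -> T,
    [/\ {in S &, injective f}, f @: S = ~: S, f @: (B :&: S) = B :\: S &
        f @: (~: B :&: S) = ~: B :\: S].
Proof.
move=> SSc BS.
have [f finj fim] := equicard_bij BS.
have BcS : #|~: B :&: S| = #|~: B :\: S|.
  apply: (@addnI #|B :&: S|); rewrite {2}BS.
  rewrite (finset.setIC B) (finset.setIC (~: B)) -finset.setDE cardsID.
  by rewrite [B :\: S]finset.setDE [~: B :\: S]finset.setDE !(finset.setIC _ (~: S)) -finset.setDE cardsID.
have [h hinj him] := equicard_bij BcS.
pose k x := if x \in B then f x else h x.
have kB : k @: (B :&: S) = B :\: S.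
  by rewrite -fim; apply: eq_in_imset => x; rewrite /k inE => /andP[-> _].
have kBc : k @: (~: B :&: S) = ~: B :\: S.
  by rewrite -him; apply: eq_in_imset => x; rewrite /k !inE => /andP[/negPf-> _].
exists k; split => //.
  have kmem x : x \in S -> (k x \in B) = (x \in B).
    move=> xS; case: (boolP (x \in B)) => xB.
      have : k x \in k @: (B :&: S) by apply: imset_f; rewrite inE xB.
      by rewrite kB !inE => /andP[].
    have : k x \in k @: (~: B :&: S) by apply: imset_f; rewrite !inE xB.
    by rewrite kBc !inE => /andP[_ /negPf].
  move=> x y xS yS kxy; have := kmem _ xS; rewrite kxy kmem // => xyB.
  move: kxy; rewrite /k xyB; case: ifP => yB exy.
    by apply: finj => //; rewrite inE ?xS ?yS ?xyB yB.
  by apply: hinj => //; rewrite !inE ?xS ?yS ?xyB yB.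
have -> : S = (B :&: S) :|: (~: B :&: S) by rewrite -finset.setIUl finset.setUCr finset.setTI.
rewrite imsetU kB kBc -finset.setDUl finset.setUCr finset.setTD.
by rewrite -finset.setIUl finset.setUCr finset.setTI.
Qed.

(** * Magnetizations and single spin flips *)

Section Spins.
Variables (R : realType) (N : nat).
Implicit Types (S B : {set 'I_N}) (s : config N).

Definition magn s : R := \sum_i spin (s i).

(** The part carried by [B] of the magnetization of [S] minus that of its complement; the full set
    gives [v]. *)
Definition stag S B s : R := \sum_(i in B) spin (i \in S) * spin (s i).

Definition flip (i : 'I_N) s : config N := [ffun k => (k == i) (+) s k].

Lemma spin_sqr (b : bool) : spin b ^+ 2 = 1 :> R.
Proof. by case: b; rewrite /spin ?sqrrN expr1n. Qed.

Lemma spinN (b : bool) : spin (~~ b) = - spin b :> R.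
Proof. by case: b; rewrite /spin ?opprK. Qed.

Lemma norm_spin (b : bool) : `|spin b| = 1 :> R.
Proof. by case: b; rewrite /spin ?normrN normr1. Qed.

Lemma spin_flip i s k : spin (flip i s k) = (-1) ^+ (k == i) * spin (s k) :> R.
Proof.
by rewrite ffunE; case: (k == i); rewrite /= ?spinN ?expr1 ?mulN1r ?expr0 ?mul1r.
Qed.

Lemma flipK i : involutive (flip i).
Proof. by move=> s; apply/ffunP => k; rewrite !ffunE addbA addbb. Qed.

Lemma norm_magn s : `|magn s| <= N%:R.
Proof.
rewrite (le_trans (ler_norm_sum _ _ _)) //.
by under eq_bigr do rewrite norm_spin; rewrite sumr_const card_ord.
Qed.

Lemma norm_stag S B s : `|stag S B s| <= N%:R.
Proof.
rewrite (le_trans (ler_norm_sum _ _ _)) //.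
under eq_bigr do rewrite normrM !norm_spin mulr1.
by rewrite sumr_const ler_nat (leq_trans (max_card _)) // card_ord.
Qed.

Lemma stagT S B s : stag S [set: 'I_N] s = stag S B s + stag S (~: B) s.
Proof.
rewrite /stag (big_setID B) /= finset.setTI; congr (_ + _).
by apply: eq_bigl => i; rewrite !inE andbT.
Qed.

Lemma magn_flip i s : magn (flip i s) = magn s - 2 * spin (s i).
Proof.
rewrite /magn (bigD1 i) //= [in RHS](bigD1 i) //= spin_flip eqxx expr1 mulN1r.
under eq_bigr => k ki do rewrite spin_flip (negPf ki) expr0 mul1r.
by ring.
Qed.

Lemma stag_flip S B i s :
  stag S B (flip i s) =
  stag S B s - 2 * (i \in B)%:R * (spin (i \in S) * spin (s i)).
Proof.
case: (boolP (i \in B)) => iB.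
  rewrite /stag (bigD1 i) //= [in RHS](bigD1 i) //= spin_flip eqxx expr1.
  under eq_bigr => k /andP[_ ki] do rewrite spin_flip (negPf ki) expr0 mul1r.
  by ring.
rewrite mulr0 mul0r subr0; apply: eq_bigr => k kB.
by rewrite spin_flip (_ : (k == i) = false) ?mul1r //; apply: contraNF iB => /eqP <-.
Qed.

End Spins.

(** * Sums and differences of paired spins as generators *)

Section PairedSpins.
Variables (R : realType) (N : nat) (S : {set 'I_N}) (f : 'I_N -> 'I_N).
Hypothesis f_inj : {in S &, injective f}.
Hypothesis f_im : f @: S = ~: S.

Definition pair_sum i (s : config N) : R := spin (s i) + spin (s (f i)).
Definition pair_diff i (s : config N) : R := spin (s i) - spin (s (f i)).

(** The value 0 off [S] lets all of ['I_N * bool] index the generators, without a subtype. *)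
Definition pair_gen (jb : 'I_N * bool) (s : config N) : R :=
  if jb.1 \in S then (if jb.2 then pair_sum jb.1 s else pair_diff jb.1 s) else 0.

(** With [jb.2] false the two paired spins are exchanged, which negates their difference and keeps
    their sum; with [jb.2] true both are also negated, which does the opposite. *)
Definition pair_swap (jb : 'I_N * bool) (s : config N) : config N :=
  if jb.1 \in S then
    [ffun k => if k == jb.1 then jb.2 (+) s (f jb.1)
               else if k == f jb.1 then jb.2 (+) s jb.1 else s k]
  else s.

Lemma pair_notin i : i \in S -> f i \notin S.
Proof.
by move=> iS; have := imset_f f iS; rewrite f_im inE.
Qed.

Lemma pair_neq i j : i \in S -> j \in S -> (f i == j) = false.
Proof. by move=> iS jS; apply: contraTF jS => /eqP <-; exact: pair_notin. Qed.

Lemma pair_eq i j : i \in S -> j \in S -> (f i == f j) = (i == j).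
Proof. by move=> iS jS; apply/eqP/eqP => [/f_inj->|->]. Qed.

Lemma pair_swap_inj jb : injective (pair_swap jb).
Proof.
apply: inv_inj => s; rewrite /pair_swap; case: (boolP (jb.1 \in S)) => [jS|] //.
apply/ffunP => k; rewrite ?jS !ffunE !eqxx pair_neq //.
case: eqP => [->|_]; first by rewrite addbA addbb.
by case: eqP => [->|_]; rewrite ?addbA ?addbb.
Qed.

Lemma pair_gen_swap jb s : pair_gen jb (pair_swap jb s) = - pair_gen jb s.
Proof.
rewrite /pair_gen /pair_swap; case: (boolP (jb.1 \in S)) => jS; last by rewrite oppr0.
rewrite /pair_sum /pair_diff !ffunE !eqxx pair_neq //.
by case: jb.2; rewrite /= ?spinN; ring.
Qed.

Lemma pair_gen_swap_neq jb kc s :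
  kc != jb -> pair_gen kc (pair_swap jb s) = pair_gen kc s.
Proof.
case: jb kc => [j b] [k c] /=; rewrite xpair_eqE negb_and => neq.
rewrite /pair_gen /pair_swap /=; case: (boolP (k \in S)) => kS //.
case: (boolP (j \in S)) => jS //.
rewrite /pair_sum /pair_diff !ffunE pair_eq // pair_neq // (eq_sym k (f j)) pair_neq //.
case: (eqVneq k j) neq => [->|] //=.
by case: c b => -[] //= _; rewrite ?spinN; ring.
Qed.

Definition pcone := gcone pair_gen.

Lemma pcone_sum_ge0 h : pcone h -> 0 <= \sum_s h s.
Proof.
by apply: gcone_sum_ge0;
  [exact: pair_swap_inj|exact: pair_gen_swap|exact: pair_gen_swap_neq].
Qed.

Lemma pcone_diff i : i \in S -> pcone (pair_diff i).
Proof.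
move=> iS; apply: eq_gcone (@gcone_gen _ _ _ pair_gen (i, false)) => s.
by rewrite /pair_gen /= iS.
Qed.

Lemma sum_block_pair (B : {set 'I_N}) (h : 'I_N -> R) :
  f @: (B :&: S) = B :\: S ->
  \sum_(i in B) h i = \sum_(i in B :&: S) (h i + h (f i)).
Proof.
move=> fB; rewrite (big_setID S) /= big_split /=; congr (_ + _).
rewrite -fB big_imset // => x y; rewrite !inE => /andP[_ xS] /andP[_ yS].
exact: f_inj.
Qed.

Lemma stag_pair (B : {set 'I_N}) s : f @: (B :&: S) = B :\: S ->
  stag R S B s = \sum_(i in B :&: S) pair_diff i s.
Proof.
move=> fB; rewrite /stag (sum_block_pair _ fB); apply: eq_bigr => i.
rewrite inE => /andP[_ iS]; rewrite iS (negPf (pair_notin iS)) /spin /pair_diff.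
by rewrite mul1r mulN1r.
Qed.

Lemma pcone_stag (B : {set 'I_N}) : f @: (B :&: S) = B :\: S -> pcone (stag R S B).
Proof.
move=> fB; apply: (@eq_gcone _ _ _ _ _ _ (fun s => esym (stag_pair s fB))).
by apply: gcone_sum => i; rewrite inE => /andP[_ iS]; exact: pcone_diff.
Qed.

Lemma pcone_magn : pcone (@magn R N).
Proof.
have fT : f @: ([set: 'I_N] :&: S) = [set: 'I_N] :\: S by rewrite finset.setTI finset.setTD.
apply: (@eq_gcone _ _ _ _ (fun s => \sum_(i in [set: 'I_N] :&: S) pair_sum i s)).
  move=> s; rewrite /magn -(sum_block_pair (fun i => spin (s i)) fT).
  by apply: eq_bigl => i; rewrite inE.
apply: gcone_sum => i; rewrite finset.setTI => iS.
apply: eq_gcone (@gcone_gen _ _ _ pair_gen (i, true)) => s.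
by rewrite /pair_gen /= iS.
Qed.

(** Exactly one of [s] and [flip i s] has opposite spins at the pair. Averaging over a flip thus
    turns the square of a pair difference into a constant. *)
Lemma pair_diff_flip i s : i \in S -> pair_diff i s ^+ 2 + pair_diff i (flip i s) ^+ 2 = 4.
Proof.
move=> iS; rewrite /pair_diff !spin_flip eqxx pair_neq // expr1 expr0.
have := spin_sqr R (s i); have := spin_sqr R (s (f i)).
set a := spin _; set b := spin _; move=> ha hb.
have -> : (b - a) ^+ 2 + (-1 * b - 1 * a) ^+ 2 = 2 * a ^+ 2 + 2 * b ^+ 2 by ring.
by rewrite ha hb; lra.
Qed.

Lemma norm_pair_diff i s : `|pair_diff i s| <= 2.
Proof. by rewrite (le_trans (ler_normB _ _)) // !norm_spin. Qed.

End PairedSpins.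

(** * Correlation of the two parts of the staggered magnetization *)

Section TiltedModel.
Variables (R : realType) (N : nat) (S : {set 'I_N}).
Variables (kp a j : R).
Hypothesis (N_gt0 : (0 < N)%N).
Hypothesis (kp_ge0 : 0 <= kp) (a_ge0 : 0 <= a) (j_ge0 : 0 <= j).
Hypothesis (kpN : kp * N%:R <= 1) (aN : a * N%:R <= 2) (jN : j * N%:R <= 3).
Implicit Types (B : {set 'I_N}) (s : config N).

(** The exponent of the tilted Gibbs weight in terms of the parts [w] and [r] of [v], with [j] the
    coupling between them. *)
Definition split_energy B s : R :=
  kp * magn R s ^+ 2 + a * (stag R S B s ^+ 2 + stag R S (~: B) s ^+ 2) +
  j * (stag R S B s * stag R S (~: B) s).

Lemma split_energyC B s : split_energy (~: B) s = split_energy B s.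
Proof. by rewrite /split_energy finset.setCK; ring. Qed.

Section Pairing.
Variables (f : 'I_N -> 'I_N) (B : {set 'I_N}).
Hypothesis f_inj : {in S &, injective f}.
Hypothesis f_im : f @: S = ~: S.
Hypothesis f_in : f @: (B :&: S) = B :\: S.
Hypothesis f_out : f @: (~: B :&: S) = ~: B :\: S.

Lemma norm_sqr_flip (c x y : R) : 0 <= c -> `|x| <= N%:R -> `|y| = 1 ->
  c * (x - 2 * y) ^+ 2 <= c * x ^+ 2 + 8 * (c * N%:R).
Proof.
move=> c0 xN y1; rewrite (mulrCA 8) -mulrDr ler_wpM2l //.
have N1 : (1 : R) <= N%:R by rewrite ler1n.
have y2 : y ^+ 2 = 1 by rewrite -real_normK ?num_real // y1 expr1n.
have := ler_norml x N%:R; rewrite xN => /esym/andP[x1 x2].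
have : y = 1 \/ y = -1.
  by move/eqP: y2; rewrite sqrf_eq1 => /orP[]/eqP; [left|right].
by case=> ->; rewrite sqrrB; lra.
Qed.

(** A flip raises the three terms by at most 8, 16 and 6, by the bounds on [kp * N], [a * N] and
    [j * N]. *)
Lemma split_energy_flip i s : i \in B ->
  split_energy B (flip i s) <= split_energy B s + 30.
Proof.
move=> iB; rewrite /split_energy magn_flip !stag_flip iB inE iB /= mulr1 mulr0 mul0r subr0.
set y := spin (i \in S) * _.
have y1 : `|y| = 1 by rewrite normrM !norm_spin mulr1.
have h1 := norm_sqr_flip kp_ge0 (norm_magn R s) (norm_spin R (s i)).
have h2 := norm_sqr_flip a_ge0 (norm_stag R S B s) y1.
set w := stag R S B s in h2 *; set r := stag R S (~: B) s.
have rN : `|j * (y * r)| <= 3.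
  rewrite normrM ger0_norm // normrM y1 mul1r.
  by apply: le_trans jN; rewrite ler_wpM2l // norm_stag.
move: rN; rewrite ler_norml => /andP[rN _].
have -> : j * ((w - 2 * y) * r) = j * (w * r) - 2 * (j * (y * r)) by ring.
rewrite !mulrDr; clearbody y w r.
by have := kpN; have := aN; lra.
Qed.

(** Expanding the interaction of one pair difference [q] with [r] to first order leaves [j (q r)^2];
    a spin flip then removes the factor [q^2]. *)
Lemma sum_diff_ge i : i \in B :&: S ->
  2 * j * \sum_s stag R S (~: B) s ^+ 2 * expR (split_energy B s) <=
  expR 40 * \sum_s pair_diff R f i s * stag R S (~: B) s * expR (split_energy B s).
Proof.
rewrite inE => /andP[iB iS].
set r := stag R S (~: B); set q := pair_diff R f i; set G := split_energy B.
(* The energy without the interaction between [q] and [r], which still lies in the cone. *)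
pose G1 s := G s - j * (q s * r s).
have cr : pcone S f r by exact: pcone_stag.
have cq : pcone S f q by exact: pcone_diff.
have cG1 : pcone S f G1.
  pose w' s := \sum_(k in (B :&: S) :\ i) pair_diff R f k s.
  apply: (@eq_gcone _ _ _ _ (fun s => kp * magn R s ^+ 2 +
     a * (stag R S B s ^+ 2 + r s ^+ 2) + j * (w' s * r s))).
    move=> s; rewrite /G1 /G /split_energy -/r.
    have -> : w' s = stag R S B s - q s.
      rewrite (stag_pair _ f_inj f_im _ f_in) [in RHS](big_setD1 i) ?inE ?iB //=.
      by rewrite addrAC subrr add0r.
    ring.
  apply: gconeD; first apply: gconeD; apply: gconeZ => //.
  - by apply: gconeX; exact: pcone_magn.
  - by apply: gconeD; apply: gconeX => //; exact: pcone_stag.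
  - apply: gconeM => //; apply: gcone_sum => k; rewrite !inE => /and3P[_ _ kS].
    exact: pcone_diff.
have GE s : expR (G s) = expR (G1 s) * expR (j * (q s * r s)).
  by rewrite -expRD subrK.
(* The difference of the two sides sums [q r e^G1 (e^(j q r) - j q r)], whose factors all lie in the
   cone. *)
have step1 : j * \sum_s q s ^+ 2 * r s ^+ 2 * expR (G1 s) <=
             \sum_s q s * r s * expR (G s).
  rewrite -subr_ge0 mulr_sumr -sumrB.
  have -> : \sum_s (q s * r s * expR (G s) - j * (q s ^+ 2 * r s ^+ 2 * expR (G1 s)))
    = \sum_s (q s * r s) * (expR (G1 s) * (expR (j * (q s * r s)) - j * (q s * r s))).
    by apply: eq_bigr => s _; rewrite GE; ring.
  apply: (pcone_sum_ge0 f_inj f_im).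
  apply: gconeM; first exact: gconeM.
  apply: gconeM; first exact: gcone_expR.
  by apply: gcone_expR_subr; apply: gconeZ => //; exact: gconeM.
have jqr s : G s <= G1 s + 10.
  rewrite /G1 -addrA lerDl addrC subr_ge0.
  rewrite (le_trans (ler_norm _)) // !normrM ger0_norm //.
  have := norm_pair_diff R f i s; have := norm_stag R S (~: B) s; rewrite -/r -/q.
  have := normr_ge0 (q s); have := normr_ge0 (r s).
  set rr := `|r s|; set qq := `|q s| => r0 q0 rN q2.
  have h1 : j * (qq * rr) <= j * (2 * N%:R) by rewrite ler_wpM2l // ler_pM.
  by have := jN; lra.
(* Since [i] is in [B], the flip at [i] leaves [r] unchanged. The exponent 40 pays 10 for dropping
   the interaction and 30 for the flip. *)
have step2 : 2 * \sum_s r s ^+ 2 * expR (G s) <=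
             expR 40 * \sum_s q s ^+ 2 * r s ^+ 2 * expR (G1 s).
  have : 4 * \sum_s r s ^+ 2 * expR (G s) =
      \sum_s q s ^+ 2 * r s ^+ 2 * expR (G s) +
      \sum_s q s ^+ 2 * r (flip i s) ^+ 2 * expR (G (flip i s)).
    rewrite [X in _ = _ + X](reindex_inj (can_inj (flipK i))) /= -big_split mulr_sumr.
    apply: eq_bigr => s _; rewrite !flipK.
    rewrite -[4](@pair_diff_flip R N S f f_im i s iS) -/q /=; ring.
  have rf s : r (flip i s) = r s.
    by rewrite /r stag_flip inE iB mulr0 mul0r subr0.
  have b1 : \sum_s q s ^+ 2 * r s ^+ 2 * expR (G s) <=
            expR 40 * \sum_s q s ^+ 2 * r s ^+ 2 * expR (G1 s).
    rewrite mulr_sumr ler_sum // => s _; rewrite (mulrCA (expR _)) ler_wpM2l //.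
      by rewrite mulr_ge0 ?sqr_ge0.
    by rewrite -expRD ler_expR; have := jqr s; lra.
  have b2 : \sum_s q s ^+ 2 * r (flip i s) ^+ 2 * expR (G (flip i s)) <=
            expR 40 * \sum_s q s ^+ 2 * r s ^+ 2 * expR (G1 s).
    rewrite mulr_sumr ler_sum // => s _; rewrite rf (mulrCA (expR _)) ler_wpM2l //.
      by rewrite mulr_ge0 ?sqr_ge0.
    by rewrite -expRD ler_expR; have := jqr s; have := split_energy_flip s iB;
       rewrite -/G; lra.
  by lra.
have : j * (2 * \sum_s r s ^+ 2 * expR (G s)) <=
       j * (expR 40 * \sum_s q s ^+ 2 * r s ^+ 2 * expR (G1 s)) by rewrite ler_wpM2l.
have : expR 40 * (j * \sum_s q s ^+ 2 * r s ^+ 2 * expR (G1 s)) <=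
       expR 40 * \sum_s q s * r s * expR (G s) by rewrite ler_wpM2l // expR_ge0.
by rewrite mulrCA => h1 h2; rewrite (le_trans _ h1) // (le_trans _ h2) //; lra.
Qed.

Lemma sum_stag_ge :
  2 * j * #|B :&: S|%:R * \sum_s stag R S (~: B) s ^+ 2 * expR (split_energy B s) <=
  expR 40 * \sum_s stag R S B s * stag R S (~: B) s * expR (split_energy B s).
Proof.
have -> : \sum_s stag R S B s * stag R S (~: B) s * expR (split_energy B s) =
  \sum_(i in B :&: S) \sum_s pair_diff R f i s * stag R S (~: B) s * expR (split_energy B s).
  rewrite exchange_big /=; apply: eq_bigr => s _.
  by rewrite (stag_pair _ f_inj f_im _ f_in) -!mulr_suml.
set T := \sum_s _ * _.
have -> : 2 * j * #|B :&: S|%:R * T = \sum_(i in B :&: S) 2 * j * T.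
  by rewrite sumr_const -mulr_natl; ring.
by rewrite [leRHS]mulr_sumr ler_sum // => i; exact: sum_diff_ge.
Qed.

End Pairing.

(** The bound for [B] controls [r^2], the one for its complement controls [w^2], and
    [v^2 <= 2 w^2 + 2 r^2] combines them with the smaller cardinal as common factor. *)
Lemma sum_stag_split_ge B : #|S| = #|~: S| -> #|B :&: S| = #|B :\: S| ->
  (#|B :&: S| <= #|~: B :&: S|)%N ->
  j * #|B :&: S|%:R * \sum_s stag R S [set: 'I_N] s ^+ 2 * expR (split_energy B s) <=
  2 * expR 40 * \sum_s stag R S B s * stag R S (~: B) s * expR (split_energy B s).
Proof.
move=> SSc BS BBc.
have [f [f_inj f_im f_in f_out]] := block_pairing SSc BS.
have h1 := sum_stag_ge f_inj f_im f_in f_out.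
have h2 : 2 * j * #|~: B :&: S|%:R *
    \sum_s stag R S B s ^+ 2 * expR (split_energy B s) <=
    expR 40 * \sum_s stag R S B s * stag R S (~: B) s * expR (split_energy B s).
  have := @sum_stag_ge f (~: B) f_inj f_im f_out; rewrite finset.setCK => /(_ f_in).
  under eq_bigr do rewrite split_energyC.
  move=> h; apply: (le_trans h); rewrite ler_wpM2l ?expR_ge0 //.
  by apply: ler_sum => s _; rewrite split_energyC (mulrC (stag R S (~: B) s)).
have hB : (#|B :&: S|%:R : R) <= #|~: B :&: S|%:R by rewrite ler_nat.
set W2 := \sum_s stag R S B s ^+ 2 * expR (split_energy B s) in h2.
set R2 := \sum_s stag R S (~: B) s ^+ 2 * expR (split_energy B s) in h1.
have W0 : 0 <= W2 by apply: sumr_ge0 => s _; rewrite mulr_ge0 ?sqr_ge0 ?expR_ge0.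
have h3 : 2 * j * #|B :&: S|%:R * W2 <= 2 * j * #|~: B :&: S|%:R * W2.
  by rewrite ler_wpM2r // ler_wpM2l // mulr_ge0.
have h4 : \sum_s stag R S [set: 'I_N] s ^+ 2 * expR (split_energy B s) <= 2 * W2 + 2 * R2.
  rewrite /W2 /R2 !mulr_sumr -big_split ler_sum //= => s _.
  rewrite !mulrA -mulrDl ler_wpM2r ?expR_ge0 // (stagT R S B).
  have := sqr_ge0 (stag R S B s - stag R S (~: B) s).
  set w := stag _ _ _ _; set r := stag _ _ _ _ => h.
  by rewrite -subr_ge0; apply: le_trans h _; rewrite le_eqVlt; apply/orP; left; apply/eqP; ring.
have h5 : j * #|B :&: S|%:R * \sum_s stag R S [set: 'I_N] s ^+ 2 * expR (split_energy B s)
  <= j * #|B :&: S|%:R * (2 * W2 + 2 * R2) by rewrite ler_wpM2l // mulr_ge0.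
by apply: (le_trans h5); lra.
Qed.

End TiltedModel.

(* From [1 - expR (- x) <= x]. *)
Lemma sum_expR_tilt_le (R : realType) (T : finType) (E X : T -> R) :
  \sum_s X s * expR (E s + X s) <= 0 ->
  \sum_s expR (E s + X s) <= \sum_s expR (E s).
Proof.
move=> h; rewrite -subr_le0 -sumrB; apply: le_trans h; apply: ler_sum => s _.
have -> : expR (E s) = expR (- X s) * expR (E s + X s).
  by rewrite -expRD; congr expR; ring.
rewrite -[X in X - _]mul1r -mulrBl ler_wpM2r ?expR_ge0 //.
by have := expR_ge1Dx (- X s); lra.
Qed.

(** * Block energy, diagonal second moment and the tilt *)

Section BlockEnergy.
Variables (R : realType) (N : nat).
Implicit Types (S B : {set 'I_N}) (s : config N) (kp kq : R).

Definition block_energy kp kq S s : R :=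
  (kp * magn R s ^+ 2 + kq * stag R S [set: 'I_N] s ^+ 2) / (2 * N%:R).

Lemma stag_setTE S s :
  stag R S [set: 'I_N] s = \sum_i spin (i \in S) * spin (s i).
Proof. by apply: eq_bigl => i; rewrite inE. Qed.

(** [u^2] and [v^2] are the sum and the difference of the within-block and cross-block pair sums. *)
Lemma hamiltonianE (alpha beta : R) S s :
  - hamiltonian alpha beta S s =
  block_energy ((alpha + beta) / 2) ((beta - alpha) / 2) S s.
Proof.
rewrite /hamiltonian /block_energy.
set P := \sum_(p | same_block S p.1 p.2) _.
set Q := \sum_(p | ~~ same_block S p.1 p.2) _.
have uE : magn R s ^+ 2 = P + Q.
  rewrite expr2 /magn mulr_suml.
  under eq_bigr do rewrite mulr_sumr.
  by rewrite pair_bigA /= (bigID (fun p => same_block S p.1 p.2)).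
have vE : stag R S [set: 'I_N] s ^+ 2 = P - Q.
  rewrite stag_setTE expr2 mulr_suml.
  under eq_bigr do rewrite mulr_sumr.
  rewrite pair_bigA /= (bigID (fun p => same_block S p.1 p.2)) /= -sumrN.
  congr (_ + _); apply: eq_bigr => -[i k] /=; rewrite /same_block /=.
    by move/eqP => ->; have := spin_sqr R (k \in S); rewrite expr2 => h;
      rewrite mulrACA h mul1r.
  by case: (i \in S) (k \in S) => -[] //= _; rewrite /spin; ring.
rewrite uE vE; move: (2 * N%:R)^-1 => c; by field.
Qed.

Lemma sum_block_energy_gt0 kp kq S : 0 < \sum_s expR (block_energy kp kq S s).
Proof.
rewrite (bigD1 [ffun=> true]) //= ltr_pwDl ?expR_gt0 //.
by apply: sumr_ge0 => s _; exact: expR_ge0.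
Qed.

Lemma stag_set0 S s : stag R S (~: [set: 'I_N]) s = 0.
Proof. by rewrite /stag finset.setCT big_set0. Qed.

(** Expand [v] in pair differences: products of distinct ones contribute nonnegatively by Griffiths'
    inequality, and each of the [N / 2] squares contributes at least a constant, by a flip. *)
Lemma second_moment_ge kp kq S : (0 < N)%N -> #|S| = #|~: S| ->
  0 <= kp <= 1 -> 0 <= kq <= 1 ->
  N%:R * \sum_s expR (block_energy kp kq S s) <=
  expR 31 * \sum_s stag R S [set: 'I_N] s ^+ 2 * expR (block_energy kp kq S s).
Proof.
move=> N0 SSc /andP[kp0 kp1] /andP[kq0 kq1].
have NR0 : (0 : R) < N%:R by rewrite ltr0n.
have [|f [f_inj f_im f_in f_out]] := @block_pairing _ S [set: 'I_N] SSc.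
  by rewrite finset.setTI finset.setTD.
set v := stag R S [set: 'I_N]; pose G := block_energy kp kq S.
(* Coupling 0 and [B] the full set make the flip bound of the tilted model available. *)
have bE s : G s = split_energy S (kp / (2 * N%:R)) (kq / (2 * N%:R)) 0 [set: 'I_N] s.
  rewrite /G /block_energy /split_energy stag_set0.
  by field; rewrite gt_eqF.
have cG : pcone S f G.
  apply: (@eq_gcone _ _ _ _ (fun s => kp / (2 * N%:R) * magn R s ^+ 2 +
     kq / (2 * N%:R) * v s ^+ 2)) => [s|].
    by rewrite /G /block_energy -/v; field; rewrite gt_eqF.
  apply: gconeD; apply: gconeZ; rewrite ?divr_ge0 ?mulr_ge0 //; apply: gconeX.
    exact: pcone_magn.
  exact: pcone_stag.
have vE s : v s = \sum_(i in S) pair_diff R f i s.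
  by rewrite /v (stag_pair _ f_inj f_im _ f_in) finset.setTI.
have lo : \sum_(i in S) \sum_s pair_diff R f i s ^+ 2 * expR (G s) <=
          \sum_s v s ^+ 2 * expR (G s).
  have -> : \sum_s v s ^+ 2 * expR (G s) =
            \sum_(i in S) \sum_s pair_diff R f i s * v s * expR (G s).
    rewrite exchange_big /=; apply: eq_bigr => s _.
    by rewrite -!mulr_suml -vE.
  apply: ler_sum => i iS; rewrite -subr_ge0 -sumrB.
  have -> : \sum_s (pair_diff R f i s * v s * expR (G s) -
                    pair_diff R f i s ^+ 2 * expR (G s)) =
     \sum_s pair_diff R f i s * (\sum_(k in S :\ i) pair_diff R f k s) * expR (G s).
    by apply: eq_bigr => s _; rewrite vE (big_setD1 i iS) /=; ring.
  apply: (pcone_sum_ge0 f_inj f_im).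
  apply: gconeM; last exact: gcone_expR.
  apply: gconeM; first exact: pcone_diff.
  by apply: gcone_sum => k; rewrite inE => /andP[_ kS]; exact: pcone_diff.
have diag i : i \in S -> 2 * \sum_s expR (G s) <=
    expR 31 * \sum_s pair_diff R f i s ^+ 2 * expR (G s).
  move=> iS; set q := pair_diff R f i.
  have : 4 * \sum_s expR (G s) =
      \sum_s q s ^+ 2 * expR (G s) + \sum_s q s ^+ 2 * expR (G (flip i s)).
    rewrite [X in _ = _ + X](reindex_inj (can_inj (flipK i))) /= -big_split mulr_sumr.
    apply: eq_bigr => s _; rewrite !flipK.
    by rewrite -[4](@pair_diff_flip R N S f f_im i s iS) -/q /=; ring.
  have b1 : \sum_s q s ^+ 2 * expR (G s) <= expR 31 * \sum_s q s ^+ 2 * expR (G s).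
    rewrite mulr_sumr ler_sum // => s _; rewrite (mulrCA (expR _)) ler_wpM2l ?sqr_ge0 //.
    by rewrite -expRD ler_expR; lra.
  have b2 : \sum_s q s ^+ 2 * expR (G (flip i s)) <=
            expR 31 * \sum_s q s ^+ 2 * expR (G s).
    rewrite mulr_sumr ler_sum // => s _; rewrite (mulrCA (expR _)) ler_wpM2l ?sqr_ge0 //.
    rewrite -expRD ler_expR !bE.
    have kN (k : R) : k / (2 * N%:R) * N%:R = k / 2 by field; rewrite gt_eqF.
    have k0 (k : R) : 0 <= k -> 0 <= k / (2 * N%:R).
      by move=> ?; rewrite divr_ge0 ?mulr_ge0.
    apply: le_trans (split_energy_flip S N0 (k0 _ kp0) (k0 _ kq0) (lexx 0) _ _ _ s (finset.in_setT i)) _.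
    by rewrite kN; lra.
    by rewrite kN; lra.
    by rewrite mul0r.
    by lra.
  by lra.
have cardS : N%:R = 2 * #|S|%:R :> R.
  have /(congr1 (fun k => k%:R : R)) := cardsC S.
  by rewrite -SSc card_ord natrD => <-; ring.
have : #|S|%:R * (2 * \sum_s expR (G s)) <= expR 31 * \sum_s v s ^+ 2 * expR (G s).
  apply: (@le_trans _ _ (expR 31 * \sum_(i in S) \sum_s pair_diff R f i s ^+ 2 * expR (G s))).
    by rewrite mulr_natl -sumr_const [leRHS]mulr_sumr ler_sum // => i iS; exact: diag.
  by rewrite ler_wpM2l ?expR_ge0.
by rewrite cardS; lra.
Qed.

(** With [c = kq / (2 N)] this is [c^2 #|B :&: S| / (2 expR 40)], the value at which
    [sum_stag_split_ge] with coupling at least [c] makes the tilt nonpositive on average. *)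
Definition tilt_rate kq B S : R :=
  kq ^+ 2 * #|B :&: S|%:R / (8 * expR 40 * N%:R ^+ 2).

Definition tilt kq S B s : R :=
  tilt_rate kq B S * stag R S [set: 'I_N] s ^+ 2 -
  kq / (2 * N%:R) * (stag R S B s * stag R S (~: B) s).

Lemma sum_tilt_le kp kq S B : (0 < N)%N -> #|S| = #|~: S| ->
  0 <= kp <= 1 -> 0 <= kq <= 1 -> #|B :&: S| = #|B :\: S| ->
  (#|B :&: S| <= #|~: B :&: S|)%N ->
  \sum_s expR (block_energy kp kq S s + tilt kq S B s) <=
  \sum_s expR (block_energy kp kq S s).
Proof.
move=> N0 SSc /andP[kp0 kp1] /andP[kq0 kq1] BS BBc.
have NR0 : (0 : R) < N%:R by rewrite ltr0n.
have e40 : 1 <= expR 40 :> R by have := expR_ge1Dx (40 : R); lra.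
set b := #|B :&: S| in BS BBc *.
have bN : (b%:R : R) <= N%:R by rewrite ler_nat (leq_trans (max_card _)) // card_ord.
set t := tilt_rate kq B S; have tE : t = kq ^+ 2 * b%:R / (8 * expR 40 * N%:R ^+ 2) by [].
have t0 : 0 <= t by rewrite tE divr_ge0 ?mulr_ge0 ?sqr_ge0 ?expR_ge0.
have tN : t * N%:R <= 1.
  have -> : t * N%:R = kq ^+ 2 * b%:R / (8 * expR 40 * N%:R).
    by rewrite tE; field; rewrite !gt_eqF ?expR_gt0.
  rewrite ler_pdivrMr ?mulr_gt0 ?expR_gt0 // mul1r.
  have : kq ^+ 2 <= 1 by rewrite expr_le1.
  have := sqr_ge0 kq; move: (kq ^+ 2) => k2 k20 k21.
  have h1 : k2 * b%:R <= 1 * N%:R by rewrite ler_pM.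
  by apply: (le_trans h1); rewrite ler_pM //; lra.
apply: sum_expR_tilt_le.
(* The block energy couples [w] and [r] with strength [kq / N]; the tilt removes half of it and adds
   [2 t] from [t v^2]. The rest is nonnegative, so the tilted weight stays in the cone. *)
pose j := kq / (2 * N%:R) + 2 * t.
have EE s : block_energy kp kq S s + tilt kq S B s =
   split_energy S (kp / (2 * N%:R)) (kq / (2 * N%:R) + t) j B s.
  rewrite /block_energy /tilt /split_energy /j -/t (stagT R S B).
  by field; rewrite gt_eqF.
under eq_bigr do rewrite EE /tilt -/t mulrBl.
rewrite sumrB subr_le0.
have kN (k : R) : k / (2 * N%:R) * N%:R = k / 2 by field; rewrite gt_eqF.
have k0 (k : R) : 0 <= k -> 0 <= k / (2 * N%:R) by move=> ?; rewrite divr_ge0 ?mulr_ge0.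
have j0 : 0 <= j by rewrite /j addr_ge0 ?k0 ?mulr_ge0.
have h1 : 0 <= kq / (2 * N%:R) + t by rewrite addr_ge0 ?k0.
have h2 : kp / (2 * N%:R) * N%:R <= 1 by rewrite kN; lra.
have h3 : (kq / (2 * N%:R) + t) * N%:R <= 2 by rewrite mulrDl kN; lra.
have h4 : j * N%:R <= 3 by rewrite mulrDl kN -mulrA; lra.
have := sum_stag_split_ge N0 (k0 _ kp0) h1 j0 h2 h3 h4 SSc BS BBc; rewrite -/b.
set V := \sum_s _; set Y := \sum_s stag R S B s * _ * _ => h.
have V0 : 0 <= V by apply: sumr_ge0 => s _; rewrite mulr_ge0 ?sqr_ge0 ?expR_ge0.
have -> : \sum_s t * stag R S [set: 'I_N] s ^+ 2 *
  expR (split_energy S (kp / (2 * N%:R)) (kq / (2 * N%:R) + t) j B s) = t * V.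
  by rewrite [RHS]mulr_sumr; apply: eq_bigr => s _; rewrite [RHS]mulrA.
have -> : \sum_s kq / (2 * N%:R) * (stag R S B s * stag R S (~: B) s) *
  expR (split_energy S (kp / (2 * N%:R)) (kq / (2 * N%:R) + t) j B s) =
  kq / (2 * N%:R) * Y.
  by rewrite [RHS]mulr_sumr; apply: eq_bigr => s _; rewrite [RHS]mulrA.
set c := kq / (2 * N%:R).
have c0 : 0 <= c by exact: k0.
have -> : t * V = c / (2 * expR 40) * (c * b%:R * V).
  by rewrite tE /c; field; rewrite !gt_eqF ?expR_gt0.
have -> : c * Y = c / (2 * expR 40) * (2 * expR 40 * Y).
  by field; rewrite gt_eqF ?expR_gt0.
rewrite ler_wpM2l ?divr_ge0 ?mulr_ge0 ?expR_ge0 //; apply: le_trans h.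
by rewrite ler_wpM2r // ler_wpM2r // /j lerDl mulr_ge0.
Qed.

End BlockEnergy.

(** * The hyperbolic tangent *)

Section Tanh.
Variable R : realType.
Implicit Types x y b c u : R.

Definition tanh x : R := 1 - 2 * (1 + expR (2 * x))^-1.

Lemma tanh_den_gt0 x : 0 < 1 + expR (2 * x).
Proof. by rewrite addr_gt0 ?expR_gt0. Qed.

Lemma is_derive_tanh x : is_derive x (1 : R) tanh (1 - tanh x ^+ 2).
Proof.
have h : 1 + expR (2 * x) != 0 by rewrite gt_eqF ?tanh_den_gt0.
have d1 : is_derive x (1 : R) (fun y => 1 + expR (2 * y)) (2 * expR (2 * x)).
  apply: is_derive_eq; rewrite /GRing.scale /=; ring.
have d2 := @is_deriveV _ (fun y => 1 + expR (2 * y)) x _ 1 h d1.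
by apply: is_derive_eq; rewrite /GRing.scale /= /tanh; field.
Qed.

Lemma tanhN x : tanh (- x) = - tanh x.
Proof.
rewrite /tanh mulrN expRN; have := expR_gt0 (2 * x); move: (expR _) => e e0.
by field; rewrite !gt_eqF ?addr_gt0.
Qed.

Lemma tanh0 : tanh 0 = 0.
Proof. by rewrite /tanh mulr0 expR0; field. Qed.

Lemma norm_tanh_le1 x : `|tanh x| <= 1.
Proof.
rewrite ler_norml /tanh; have := tanh_den_gt0 x.
have e0 := expR_gt0 (2 * x) => d0.
have : 0 < (1 + expR (2 * x))^-1 by rewrite invr_gt0.
have : (1 + expR (2 * x))^-1 <= 1 by rewrite invf_le1 //; lra.
by move=> h1 h2; lra.
Qed.

(** Says that [tanh x] is the mean of a spin with weights [e^x] and [e^(-x)]. *)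
Lemma tanh_balance x : (1 - tanh x) * expR x = (1 + tanh x) * expR (- x).
Proof.
rewrite /tanh (_ : 2 * x = x + x); last by ring.
rewrite expRD expRN; have := expR_gt0 x; move: (expR x) => e e0.
by field; rewrite !gt_eqF // addr_gt0 // mulr_gt0.
Qed.

Lemma tanh_mean_value x y : y <= x ->
  exists2 c, y <= c <= x & tanh x - tanh y = (1 - tanh c ^+ 2) * (x - y).
Proof.
move=> yx.
have cont : {within `[y, x], continuous tanh}%classic.
  apply: derivable_within_continuous => z _.
  by have [] := is_derive_tanh z.
have [c] := MVT_segment yx (fun z _ => is_derive_tanh z) cont.
by rewrite in_itv /=; exists c.
Qed.

Lemma tanh_lip x y : `|tanh x - tanh y| <= `|x - y|.
Proof.
wlog yx : x y / y <= x.
  move=> h; case: (leP y x) => [|/ltW]; first exact: h.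
  by rewrite distrC (distrC x); exact: h.
have [c _ ->] := tanh_mean_value yx.
have := norm_tanh_le1 c; rewrite -ler_sqr ?nnegrE // expr1n real_normK ?num_real // => t1.
have := sqr_ge0 (tanh c) => t0.
rewrite normrM ler_piMl // ger0_norm; lra.
Qed.

Lemma norm_tanh_le x : `|tanh x| <= `|x|.
Proof. by have := tanh_lip x 0; rewrite tanh0 !subr0. Qed.

(** By the mean value theorem the slope is [1 - tanh z ^+ 2] at some [z] between the two arguments,
    where [tanh z ^+ 2 <= z^2 <= 2 ((c u)^2 + b^2)]. The upper bound linearizes; the lower one keeps
    the cubic loss. *)
Lemma tanh_increment b c u : 0 <= c ->
  2 * c * u ^+ 2 * (1 - 2 * ((c * u) ^+ 2 + b ^+ 2)) <=
    u * (tanh (b + c * u) - tanh (b - c * u)) <= 2 * c * u ^+ 2.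
Proof.
move=> c0; wlog u0 : u / 0 <= u.
  move=> h; case: (leP 0 u) => [|/ltW u0]; first exact: h.
  have := h (- u); rewrite oppr_ge0 => /(_ u0).
  rewrite !mulrN !sqrrN opprK.
  have -> : - u * (tanh (b - c * u) - tanh (b + c * u)) =
            u * (tanh (b + c * u) - tanh (b - c * u)) by ring.
  by [].
have cu0 : 0 <= c * u by rewrite mulr_ge0.
have le : b - c * u <= b + c * u by lra.
have [z /andP[z1 z2] ->] := tanh_mean_value le.
have zb : z ^+ 2 <= 2 * ((c * u) ^+ 2 + b ^+ 2).
  move: z1 z2 cu0; move: (c * u) => a z1 z2 a0.
  have h : 0 <= (a - (z - b)) * (a + (z - b)) by rewrite mulr_ge0 //; lra.
  have := sqr_ge0 (z - 2 * b); lra.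
have t0 := sqr_ge0 (tanh z).
have tz : tanh z ^+ 2 <= z ^+ 2.
  rewrite -[leLHS]real_normK ?num_real // -[leRHS]real_normK ?num_real //.
  by rewrite ler_sqr ?nnegrE // norm_tanh_le.
have -> : u * ((1 - tanh z ^+ 2) * (b + c * u - (b - c * u))) =
          2 * c * u ^+ 2 * (1 - tanh z ^+ 2) by ring.
have k0 : 0 <= 2 * c * u ^+ 2 by rewrite mulr_ge0 ?sqr_ge0 ?mulr_ge0.
apply/andP; split; first by rewrite ler_wpM2l //; lra.
by rewrite ler_piMr //; lra.
Qed.

End Tanh.

(** * Spin identities and moments near the critical coupling *)

(** A unit shift changes a cubic by a quadratic amount; this serves to remove one spin from
    [v (v^2 + u^2)]. *)
Lemma norm_cubic_shift (R : realType) (a b y z : R) : y = 1 \/ y = -1 -> z = 1 \/ z = -1 ->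
  `|a * (a ^+ 2 + b ^+ 2) - (a - y) * ((a - y) ^+ 2 + (b - z) ^+ 2)| <=
  6 * (a ^+ 2 + b ^+ 2 + 1).
Proof.
move=> hy hz; have := (sqr_ge0 (a + b), sqr_ge0 (a - b), sqr_ge0 (a + 1), sqr_ge0 (a - 1),
  sqr_ge0 (b + 1), sqr_ge0 (b - 1)).
move=> [[[[[h1 h2] h3] h4] h5] h6].
by rewrite ler_norml; apply/andP; split; case: hy => ->; case: hz => ->; nra.
Qed.

Section NearCritical.
Variables (R : realType) (N : nat) (S : {set 'I_N}) (kp kq : R).
Hypothesis (N_gt0 : (0 < N)%N).
Hypothesis (cardS : #|S| = #|~: S|).
Hypothesis (kp01 : 0 <= kp <= 1) (kq01 : 0 <= kq <= 1).
Implicit Types (s : config N) (F : config N -> R).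

Let n : R := N%:R.
Let u s := magn R s.
Let v s := stag R S [set: 'I_N] s.
Let x i : R := spin (i \in S).
Let sg i s : R := spin (s i).
Let y i s := x i * sg i s.

Let n_gt0 : 0 < n. Proof. by rewrite /n ltr0n. Qed.

(** Unnormalized expectation: the bounds below carry the total weight [Z] instead of dividing by
    it. *)
Definition bsum F := \sum_s F s * expR (block_energy kp kq S s).

(** The field on the gauged spin [y i], without self-interaction, so that a flip at [i] does not
    change it. *)
Definition local_field i s : R := (kq * (v s - y i s) + kp * x i * (u s - sg i s)) / n.

Let xx i : x i * x i = 1. Proof. by rewrite -expr2 spin_sqr. Qed.
Let sgsg i s : sg i s * sg i s = 1. Proof. by rewrite -expr2 spin_sqr. Qed.
Let yy i s : y i s * y i s = 1. Proof. by rewrite mulrACA xx sgsg mulr1. Qed.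
Let y_pm i s : y i s = 1 \/ y i s = -1.
Proof.
have /eqP := yy i s; rewrite -expr2 sqrf_eq1 => /orP[]/eqP; [by left|by right].
Qed.

Let v_flip i s : v (flip i s) = v s - 2 * y i s.
Proof. by rewrite /v stag_flip inE mulr1. Qed.
Let u_flip i s : u (flip i s) = u s - 2 * sg i s.
Proof. exact: magn_flip. Qed.
Let sg_flip i s : sg i (flip i s) = - sg i s.
Proof. by rewrite /sg spin_flip eqxx expr1 mulN1r. Qed.
Let y_flip i s : y i (flip i s) = - y i s.
Proof. by rewrite /y sg_flip mulrN. Qed.

Lemma local_field_flip i s : local_field i (flip i s) = local_field i s.
Proof. rewrite /local_field v_flip u_flip y_flip sg_flip; congr (_ / _); ring. Qed.

Lemma block_energy_flip i s :
  block_energy kp kq S (flip i s) =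
  block_energy kp kq S s - 2 * (y i s * local_field i s).
Proof.
rewrite /block_energy -/(u (flip i s)) -/(v (flip i s)) v_flip u_flip -/(u s) -/(v s).
rewrite /local_field -/n.
have -> : y i s * ((kq * (v s - y i s) + kp * x i * (u s - sg i s)) / n) =
  (kq * (y i s * v s - y i s * y i s) + kp * (x i * x i) * (sg i s * u s - sg i s * sg i s)) / n.
  by rewrite /y; field; rewrite gt_eqF.
rewrite yy xx sgsg.
have -> : (u s - 2 * sg i s) ^+ 2 = u s ^+ 2 - 4 * (sg i s * u s) + 4 * (sg i s * sg i s) by ring.
have -> : (v s - 2 * y i s) ^+ 2 = v s ^+ 2 - 4 * (y i s * v s) + 4 * (y i s * y i s) by ring.
by rewrite yy sgsg; field; rewrite gt_eqF.
Qed.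

(* The conditional mean of the gauged spin [y i] given the others is
   [tanh (local_field i)]. *)
Lemma bsum_spin i F : (forall s, F (flip i s) = F s) ->
  bsum (fun s => F s * y i s) = bsum (fun s => F s * tanh (local_field i s)).
Proof.
move=> Fi; apply/eqP; rewrite -subr_eq0 -sumrB.
(* Adding the sum to its reindexing by the flip at [i] makes the terms cancel through
   [tanh_balance]. *)
set T := \sum_s _; suff : T + T = 0 by move=> h; apply/eqP; lra.
rewrite {2}/T (reindex_inj (can_inj (flipK i))) -big_split big1 //= => s _.
rewrite Fi local_field_flip y_flip block_energy_flip expRD.
set e := expR (block_energy _ _ _ _); set h := local_field i s.
have := tanh_balance h; set t := tanh h.
rewrite expRN; have : expR h != 0 by rewrite gt_eqF ?expR_gt0.
have e2 (c : R) : expR (- (2 * (c * h))) = expR (- (c * h)) * expR (- (c * h)).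
  by rewrite -expRD; congr expR; ring.
case: (y_pm i s) => ->.
  rewrite e2 mul1r expRN; move: (expR h) => a a0 bal.
  have -> : F s * 1 * e - F s * t * e +
      (F s * (-1) * (e * (a^-1 * a^-1)) - F s * t * (e * (a^-1 * a^-1))) =
    F s * e / a * ((1 - t) * a - (1 + t) / a) by field.
  by rewrite bal subrr mulr0.
rewrite e2 !mulN1r !opprK; move: (expR h) => a a0 bal.
have -> : F s * (-1) * e - F s * t * e +
    (F s * 1 * (e * (a * a)) - F s * t * (e * (a * a))) =
  F s * e * a * ((1 - t) * a - (1 + t) / a) by field.
by rewrite bal subrr mulr0.
Qed.

Lemma bsumD F1 F2 : bsum (fun s => F1 s + F2 s) = bsum F1 + bsum F2.
Proof. by rewrite /bsum -big_split; apply: eq_bigr => s _; rewrite mulrDl. Qed.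

Lemma bsumZ c F : bsum (fun s => c * F s) = c * bsum F.
Proof. by rewrite /bsum mulr_sumr; apply: eq_bigr => s _; rewrite mulrA. Qed.

Lemma bsum_sum (F : 'I_N -> config N -> R) :
  bsum (fun s => \sum_i F i s) = \sum_i bsum (F i).
Proof.
by rewrite /bsum exchange_big; apply: eq_bigr => s _; rewrite mulr_suml.
Qed.

Lemma ler_bsum F1 F2 : (forall s, F1 s <= F2 s) -> bsum F1 <= bsum F2.
Proof. by move=> h; apply: ler_sum => s _; rewrite ler_wpM2r ?expR_ge0. Qed.

Lemma eq_bsum F1 F2 : F1 =1 F2 -> bsum F1 = bsum F2.
Proof. by move=> h; apply: eq_bigr => s _; rewrite h. Qed.

(** The local field with its self-interaction put back. It depends on the site only through the
    block sign [e], so sums over sites take two values. *)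
Let hb (e : R) s : R := (kp * e * u s + kq * v s) / n.

Lemma sum_sign (g : R -> R) : \sum_i g (x i) = n / 2 * (g 1 + g (-1)).
Proof.
have cS : n = 2 * #|S|%:R.
  have /(congr1 (fun k => k%:R : R)) := cardsC S.
  by rewrite -cardS card_ord natrD /n => <-; ring.
rewrite (bigID (mem S)) /=.
have -> : \sum_(i | i \in S) g (x i) = #|S|%:R * g 1.
  by rewrite mulr_natl -sumr_const; apply: eq_bigr => i; rewrite /x => ->.
have -> : \sum_(i | i \notin S) g (x i) = #|S|%:R * g (-1).
  rewrite cardS mulr_natl -sumr_const.
  by apply: eq_big => [i|i]; rewrite ?inE // /x => /negPf ->.
by rewrite cS; field.
Qed.

Let un s : `|u s| <= n. Proof. exact: norm_magn. Qed.
Let vn s : `|v s| <= n. Proof. exact: norm_stag. Qed.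

Lemma tanh_field_near i s : `|tanh (local_field i s) - tanh (hb (x i) s)| <= 2 / n.
Proof.
apply: le_trans (tanh_lip _ _) _.
have -> : local_field i s - hb (x i) s = - (kq * y i s + kp * y i s) / n.
  by rewrite /local_field /hb /y; field; rewrite gt_eqF.
rewrite normrM normfV (gtr0_norm n_gt0) ler_pM2r ?invr_gt0 // normrN -mulrDl.
rewrite normrM; have -> : `|y i s| = 1 by rewrite /y normrM !norm_spin mulr1.
move: kp01 kq01 => /andP[? ?] /andP[? ?]; rewrite ger0_norm; lra.
Qed.

Lemma norm_local_field i s : `|local_field i s| <= (`|u s| + `|v s| + 2) / n.
Proof.
rewrite normrM normfV (gtr0_norm n_gt0) ler_pM2r ?invr_gt0 //.
move: kp01 kq01 => /andP[p0 p1] /andP[q0 q1].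
have h1 : `|kq * (v s - y i s)| <= `|v s| + 1.
  rewrite normrM (ger0_norm q0).
  have h : `|v s - y i s| <= `|v s| + 1.
    by apply: le_trans (ler_normB _ _) _; rewrite /y [X in _ + X]normrM !norm_spin mulr1.
  by apply: le_trans h; rewrite ler_piMl.
have h2 : `|kp * x i * (u s - sg i s)| <= `|u s| + 1.
  rewrite !normrM (ger0_norm p0) norm_spin mulr1.
  have h : `|u s - sg i s| <= `|u s| + 1.
    by apply: le_trans (ler_normB _ _) _; rewrite norm_spin.
  by apply: le_trans h; rewrite ler_piMl.
by apply: le_trans (ler_normD _ _) _; lra.
Qed.

Let Z := bsum (fun=> 1).
Let U := bsum (fun s => u s ^+ 2).
Let V := bsum (fun s => v s ^+ 2).
Let Q := bsum (fun s => v s ^+ 2 * (v s ^+ 2 + u s ^+ 2)).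

(** Write [u^2] as the sum of [sg i * u] and replace each spin by its conditional mean, at a cost of
    4 per site; linearizing tanh then gives [U <= kp * U + 4 * n * Z]. *)
Lemma bsum_magn_sqr_le : (1 - kp) * U <= 4 * n * Z.
Proof.
move: kp01 kq01 => /andP[p0 p1] /andP[q0 q1].
have step : U <= bsum (fun s => \sum_i (x i * tanh (hb (x i) s) * u s + 4)).
  have -> : U = bsum (fun s => \sum_i sg i s * u s).
    by apply: eq_bsum => s; rewrite -mulr_suml -expr2.
  rewrite !bsum_sum; apply: ler_sum => i _.
  have -> : bsum (fun s => sg i s * u s) =
            bsum (fun s => x i * (u s - sg i s) * tanh (local_field i s) + 1).
    rewrite bsumD -bsum_spin; last by move=> s; rewrite u_flip sg_flip; ring.
    rewrite -bsumD; apply: eq_bsum => s.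
    have -> : x i * (u s - sg i s) * y i s + 1 =
      (x i * x i) * (sg i s * u s - sg i s * sg i s) + 1 by rewrite /y; ring.
    by rewrite xx sgsg; ring.
  apply: ler_bsum => s.
  have h1 := tanh_field_near i s; have h2 := norm_tanh_le1 (local_field i s).
  set t := tanh (local_field i s) in h1 h2 *; set t' := tanh _ in h1 *.
  have e1 : `|x i * u s * (t - t')| <= 2.
    rewrite !normrM norm_spin mul1r.
    have -> : 2 = n * (2 / n) by field; rewrite gt_eqF.
    by rewrite ler_pM.
  have e2 : `|x i * sg i s * t| <= 1 by rewrite !normrM !norm_spin !mul1r.
  move: e1 e2; rewrite !ler_norml => /andP[_ e1] /andP[e2 _]; lra.
have pw s : \sum_i (x i * tanh (hb (x i) s) * u s + 4) <= kp * u s ^+ 2 + 4 * n.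
  rewrite (sum_sign (fun e => e * tanh (hb e s) * u s + 4)).
  have kn0 : 0 <= kp / n by rewrite divr_ge0 // ltW.
  have /andP[_] := tanh_increment (kq * v s / n) (u s) kn0.
  have -> : kq * v s / n + kp / n * u s = hb 1 s by rewrite /hb; field; rewrite gt_eqF.
  have -> : kq * v s / n - kp / n * u s = hb (-1) s by rewrite /hb; field; rewrite gt_eqF.
  set t1 := tanh _; set t2 := tanh _ => h.
  have : n / 2 * (u s * (t1 - t2)) <= n / 2 * (2 * (kp / n) * u s ^+ 2).
    by rewrite ler_wpM2l // divr_ge0 // ltW.
  have -> : n / 2 * (2 * (kp / n) * u s ^+ 2) = kp * u s ^+ 2.
    by field; rewrite gt_eqF.
  lra.
have := le_trans step (ler_bsum pw).
have -> : bsum (fun s => kp * u s ^+ 2 + 4 * n) = kp * U + 4 * n * Z.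
  rewrite bsumD bsumZ; congr (_ + _).
  by rewrite -bsumZ; apply: eq_bsum => s; rewrite mulr1.
lra.
Qed.

Let P s : R := v s ^+ 2 + u s ^+ 2 + 1.

Let sum_y s : \sum_i y i s = v s.
Proof. by rewrite /v stag_setTE. Qed.

Let bsumP : bsum P = V + U + Z.
Proof. by rewrite /P !bsumD. Qed.

Let sg_pm i s : sg i s = 1 \/ sg i s = -1.
Proof. by rewrite /sg /spin; case: (s i); [left|right]. Qed.

(** The same argument with [v] times the cubic [phi]. The cost per site is 14 [P]: 2 for the change
    of field, and twice 6 for removing one spin from [phi]. *)
Lemma bsum_quartic_le : (1 - kq) * Q <= 14 * n * (V + U + Z).
Proof.
move: kp01 kq01 => /andP[p0 p1] /andP[q0 q1].
pose phi s := v s * (v s ^+ 2 + u s ^+ 2).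
pose psi i s := (v s - y i s) * ((v s - y i s) ^+ 2 + (u s - sg i s) ^+ 2).
have near i s : `|phi s - psi i s| <= 6 * P s.
  exact: norm_cubic_shift (y_pm i s) (sg_pm i s).
have step : Q <= bsum (fun s => \sum_i (tanh (hb (x i) s) * phi s + 14 * P s)).
  have -> : Q = bsum (fun s => \sum_i y i s * phi s).
    apply: eq_bsum => s; rewrite -mulr_suml sum_y /phi; ring.
  rewrite !bsum_sum; apply: ler_sum => i _.
  have -> : bsum (fun s => y i s * phi s) =
            bsum (fun s => psi i s * tanh (local_field i s) + y i s * (phi s - psi i s)).
    rewrite bsumD -bsum_spin; last first.
      by move=> s; rewrite /psi v_flip y_flip u_flip sg_flip; congr (_ * (_ ^+ 2 + _ ^+ 2)); ring.
    by rewrite -bsumD; apply: eq_bsum => s; ring.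
  apply: ler_bsum => s.
  have h1 := tanh_field_near i s; have h2 := norm_tanh_le1 (local_field i s).
  set t := tanh (local_field i s) in h1 h2 *; set t' := tanh _ in h1 *.
  have P0 : 0 <= P s by rewrite /P !addr_ge0 ?sqr_ge0.
  have e1 : `|phi s * (t - t')| <= 2 * P s.
    have e : `|phi s| <= n * P s.
      rewrite /phi normrM ler_pM //.
      by rewrite ger0_norm ?addr_ge0 ?sqr_ge0 // /P lerDl.
    rewrite normrM (_ : 2 * P s = (n * P s) * (2 / n)); last by field; rewrite gt_eqF.
    by rewrite ler_pM.
  have e2 : `|(phi s - psi i s) * t| <= 6 * P s.
    by rewrite normrM (le_trans _ (near i s)) // ler_piMr.
  have e3 : `|y i s * (phi s - psi i s)| <= 6 * P s.
    by rewrite normrM /y normrM !norm_spin !mul1r; exact: near.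
  move: e1 e2 e3; rewrite !ler_norml => /andP[_ e1] /andP[e2 _] /andP[_ e3]; lra.
have pw s : \sum_i (tanh (hb (x i) s) * phi s + 14 * P s) <=
            kq * (v s ^+ 2 * (v s ^+ 2 + u s ^+ 2)) + 14 * n * P s.
  rewrite (sum_sign (fun e => tanh (hb e s) * phi s + 14 * P s)).
  have kn0 : 0 <= kq / n by rewrite divr_ge0 // ltW.
  have /andP[_] := tanh_increment (kp * u s / n) (v s) kn0.
  have -> : kp * u s / n + kq / n * v s = hb 1 s by rewrite /hb; field; rewrite gt_eqF.
  have -> : kp * u s / n - kq / n * v s = - hb (-1) s.
    by rewrite /hb; field; rewrite gt_eqF.
  rewrite tanhN opprK; set t1 := tanh _; set t2 := tanh _ => h.
  have w0 : 0 <= v s ^+ 2 + u s ^+ 2 by rewrite addr_ge0 ?sqr_ge0.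
  have : n / 2 * (v s ^+ 2 + u s ^+ 2) * (v s * (t1 + t2)) <=
         n / 2 * (v s ^+ 2 + u s ^+ 2) * (2 * (kq / n) * v s ^+ 2).
    by rewrite ler_wpM2l // mulr_ge0 // divr_ge0 // ltW.
  have -> : n / 2 * (v s ^+ 2 + u s ^+ 2) * (2 * (kq / n) * v s ^+ 2) =
            kq * (v s ^+ 2 * (v s ^+ 2 + u s ^+ 2)).
    by field; rewrite gt_eqF.
  have -> : n / 2 * (v s ^+ 2 + u s ^+ 2) * (v s * (t1 + t2)) =
    n / 2 * (t1 * phi s + t2 * phi s) by rewrite /phi; ring.
  by move=> h3; lra.
have := le_trans step (ler_bsum pw).
have -> : bsum (fun s => kq * (v s ^+ 2 * (v s ^+ 2 + u s ^+ 2)) + 14 * n * P s) =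
          kq * Q + 14 * n * (V + U + Z).
  by rewrite bsumD !bsumZ bsumP.
lra.
Qed.

(** Now tanh is bounded from below: the diagonal gives [n * Z], the linear part [kq * V], and the
    cubic loss costs [2 / n ^+ 2 * Q]. The other terms are field errors. *)
Lemma bsum_stag_sqr_ge :
  n * Z <= (1 - kq) * V + 2 / n ^+ 2 * Q + (n / 4 + 2) * Z + 18 / n * V + 2 / n * U.
Proof.
move: kp01 kq01 => /andP[p0 p1] /andP[q0 q1].
have step : bsum (fun s => \sum_i (1 + tanh (hb (x i) s) * v s -
    (3 * `|v s| + `|u s| + 2) / n)) <= V.
  have -> : V = bsum (fun s => \sum_i y i s * v s).
    apply: eq_bsum => s; by rewrite -mulr_suml sum_y expr2.
  rewrite !bsum_sum; apply: ler_sum => i _.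
  have -> : bsum (fun s => y i s * v s) =
            bsum (fun s => (v s - y i s) * tanh (local_field i s) + 1).
    rewrite bsumD -bsum_spin; last by move=> s; rewrite v_flip y_flip; ring.
    by rewrite -bsumD; apply: eq_bsum => s; rewrite mulrBl yy; ring.
  apply: ler_bsum => s.
  have h1 := tanh_field_near i s.
  have h2 := le_trans (norm_tanh_le (local_field i s)) (norm_local_field i s).
  set t := tanh (local_field i s) in h1 h2 *; set t' := tanh _ in h1 *.
  have e1 : `|v s * (t - t')| <= `|v s| * (2 / n) by rewrite normrM ler_wpM2l.
  have e2 : `|y i s * t| <= (`|u s| + `|v s| + 2) / n.
    by rewrite /y !normrM !norm_spin !mul1r.
  have -> : (3 * `|v s| + `|u s| + 2) / n =
            `|v s| * (2 / n) + (`|u s| + `|v s| + 2) / n by field; rewrite gt_eqF.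
  move: e1 e2; set A := `|v s| * _; set C := _ / n.
  rewrite !ler_norml => /andP[e1 _] /andP[_ e2]; lra.
have pw s : n + kq * v s ^+ 2 - 2 / n ^+ 2 * (v s ^+ 2 * (v s ^+ 2 + u s ^+ 2))
            - (n / 4 + 2) - 18 / n * v s ^+ 2 - 2 / n * u s ^+ 2 <=
   \sum_i (1 + tanh (hb (x i) s) * v s - (3 * `|v s| + `|u s| + 2) / n).
  rewrite (sum_sign (fun e => 1 + tanh (hb e s) * v s - (3 * `|v s| + `|u s| + 2) / n)).
  have kn0 : 0 <= kq / n by rewrite divr_ge0 // ltW.
  have /andP[] := tanh_increment (kp * u s / n) (v s) kn0.
  have -> : kp * u s / n + kq / n * v s = hb 1 s by rewrite /hb; field; rewrite gt_eqF.
  have -> : kp * u s / n - kq / n * v s = - hb (-1) s.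
    by rewrite /hb; field; rewrite gt_eqF.
  rewrite tanhN opprK; set t1 := tanh _; set t2 := tanh _ => h _.
  have sq1 : (kq / n * v s) ^+ 2 + (kp * u s / n) ^+ 2 <= (v s ^+ 2 + u s ^+ 2) / n ^+ 2.
    have -> : (kq / n * v s) ^+ 2 + (kp * u s / n) ^+ 2 =
      (kq ^+ 2 * v s ^+ 2 + kp ^+ 2 * u s ^+ 2) / n ^+ 2 by field; rewrite gt_eqF.
    rewrite ler_pM2r ?invr_gt0 ?exprn_gt0 // lerD // ler_piMl ?sqr_ge0 //.
      by rewrite expr_le1.
    by rewrite expr_le1.
  have h3 : n / 2 * (2 * (kq / n) * v s ^+ 2 *
      (1 - 2 * ((kq / n * v s) ^+ 2 + (kp * u s / n) ^+ 2))) <=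
      n / 2 * (v s * (t1 + t2)) by rewrite ler_wpM2l // divr_ge0 // ltW.
  have h4 : kq * v s ^+ 2 * (1 - 2 * ((v s ^+ 2 + u s ^+ 2) / n ^+ 2)) <=
      n / 2 * (v s * (t1 + t2)).
    apply: le_trans h3.
    have -> : n / 2 * (2 * (kq / n) * v s ^+ 2 *
      (1 - 2 * ((kq / n * v s) ^+ 2 + (kp * u s / n) ^+ 2))) =
      kq * v s ^+ 2 * (1 - 2 * ((kq / n * v s) ^+ 2 + (kp * u s / n) ^+ 2)).
      by field; rewrite gt_eqF.
    apply: ler_wpM2l; first by rewrite mulr_ge0 ?sqr_ge0.
    by apply: lerB => //; rewrite ler_wpM2l.
  have h5 : kq * (2 / n ^+ 2 * (v s ^+ 2 * (v s ^+ 2 + u s ^+ 2))) <=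
            2 / n ^+ 2 * (v s ^+ 2 * (v s ^+ 2 + u s ^+ 2)).
    apply: ler_piMl => //; apply: mulr_ge0; first by rewrite divr_ge0 ?sqr_ge0.
    by apply: mulr_ge0; rewrite ?sqr_ge0 // addr_ge0 ?sqr_ge0.
  (* The linear errors are absorbed by completing squares, at a cost of [n / 8] here and again for
     [u]. *)
  have h6 : 3 * `|v s| <= n / 8 + 18 / n * v s ^+ 2.
    have -> : v s ^+ 2 = `|v s| ^+ 2 by rewrite real_normK ?num_real.
    move: `|v s| => a; rewrite -subr_ge0.
    have -> : n / 8 + 18 / n * a ^+ 2 - 3 * a = (n - 12 * a) ^+ 2 / (8 * n).
      by field; rewrite gt_eqF.
    by rewrite divr_ge0 ?sqr_ge0 // mulr_ge0 // ltW.
  have h7 : `|u s| <= n / 8 + 2 / n * u s ^+ 2.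
    have -> : u s ^+ 2 = `|u s| ^+ 2 by rewrite real_normK ?num_real.
    move: `|u s| => a; rewrite -subr_ge0.
    have -> : n / 8 + 2 / n * a ^+ 2 - a = (n - 4 * a) ^+ 2 / (8 * n).
      by field; rewrite gt_eqF.
    by rewrite divr_ge0 ?sqr_ge0 // mulr_ge0 // ltW.
  have -> : n / 2 * (1 + t1 * v s - (3 * `|v s| + `|u s| + 2) / n +
     (1 + t2 * v s - (3 * `|v s| + `|u s| + 2) / n)) =
     n + n / 2 * (v s * (t1 + t2)) - (3 * `|v s| + `|u s| + 2).
    by field; rewrite gt_eqF.
  have e4 : kq * v s ^+ 2 * (1 - 2 * ((v s ^+ 2 + u s ^+ 2) / n ^+ 2)) =
    kq * v s ^+ 2 - kq * (2 / n ^+ 2 * (v s ^+ 2 * (v s ^+ 2 + u s ^+ 2))).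
    by field; rewrite gt_eqF.
  rewrite {}e4 in h4.
  move: h4 h5 h6 h7; set A := kq * (2 / _ * _); set C := 2 / _ * _.
  set D := n / 2 * _; set E := 18 / n * _; set F := 2 / n * _; set H := kq * _; lra.
have := le_trans (ler_bsum pw) step.
have -> : bsum (fun s => n + kq * v s ^+ 2 - 2 / n ^+ 2 * (v s ^+ 2 * (v s ^+ 2 + u s ^+ 2))
            - (n / 4 + 2) - 18 / n * v s ^+ 2 - 2 / n * u s ^+ 2) =
   n * Z + kq * V - 2 / n ^+ 2 * Q - (n / 4 + 2) * Z - 18 / n * V - 2 / n * U.
  have lin (c1 c2 c3 c4 : R) :
      bsum (fun s => c1 * 1 + c2 * v s ^+ 2 + c3 * u s ^+ 2 +
                     c4 * (v s ^+ 2 * (v s ^+ 2 + u s ^+ 2))) =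
      c1 * Z + c2 * V + c3 * U + c4 * Q by rewrite !bsumD !bsumZ.
  transitivity ((n - (n / 4 + 2)) * Z + (kq - 18 / n) * V + (- (2 / n)) * U +
                (- (2 / n ^+ 2)) * Q); last by ring.
  by rewrite -lin; apply: eq_bsum => s; ring.
lra.
Qed.

End NearCritical.

(** At distance [1 / m] from criticality, with [m] the root of [N], the three moment bounds close
    up: [U] is of order [m^2 Z] and [Q] at most of order [m^3 (V + U + Z)], which forces [V] to be
    at least of order [m^3 Z]. *)
Lemma critical_second_moment_ge (R : realType) (kp : R) : 0 <= kp < 1 ->
  exists2 c : R, 0 < c & forall (N : nat) (S : {set 'I_N}),
    (0 < N)%N -> #|S| = #|~: S| ->
    c * (N%:R * Num.sqrt N%:R) *
      \sum_s expR (block_energy kp (1 - (Num.sqrt N%:R)^-1) S s) <=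
    \sum_s stag R S [set: 'I_N] s ^+ 2 *
      expR (block_energy kp (1 - (Num.sqrt N%:R)^-1) S s).
Proof.
move=> /andP[kp0 kp1].
pose C := 4 / (1 - kp); have C4 : 4 <= C.
  by rewrite /C ler_pdivlMr ?subr_gt0 //; lra.
(* [M] is the value of [m] beyond which the cubic term beats all errors. The constant
   [c1 = 1 / (4 * 47)] serves beyond it, [c2] below it. *)
pose M := 60 * (C + 1); have M0 : 0 < M by rewrite /M; lra.
pose c1 : R := 188^-1; pose c2 : R := (expR 31 * M)^-1.
exists (Num.min c1 c2) => [|N S N0 SSc].
  by rewrite lt_min /c1 /c2 !invr_gt0 ltr0n mulr_gt0 ?expR_gt0.
set m : R := Num.sqrt N%:R.
have m1 : 1 <= m by rewrite -sqrtr1 ler_wsqrtr // ler1n.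
have m0 : 0 < m by lra.
have Nm : N%:R = m ^+ 2 :> R by rewrite sqr_sqrtr.
have kq01 : 0 <= 1 - m^-1 <= 1.
  have : m^-1 <= 1 by rewrite invf_le1.
  have : 0 < m^-1 by rewrite invr_gt0.
  by move=> h1 h2; apply/andP; split; lra.
have kp01 : 0 <= kp <= 1 by rewrite kp0 ltW.
have hU := bsum_magn_sqr_le N0 SSc kp01 kq01.
have hQ := bsum_quartic_le N0 SSc kp01 kq01.
have hV := bsum_stag_sqr_ge N0 SSc kp01 kq01.
have hL := second_moment_ge N0 SSc kp01 kq01.
rewrite -/(bsum S kp (1 - m^-1) (fun s => stag R S [set: 'I_N] s ^+ 2)) in hL *.
have ZE : \sum_s expR (block_energy kp (1 - m^-1) S s) = bsum S kp (1 - m^-1) (fun=> 1).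
  by apply: eq_bigr => s _; rewrite mul1r.
have Z0 : 0 < bsum S kp (1 - m^-1) (fun=> 1).
  by rewrite -ZE sum_block_energy_gt0.
rewrite ZE in hL *.
move: hU hQ hV hL Z0; rewrite Nm.
set Z := bsum _ _ _ (fun=> 1); set V := bsum _ _ _ (fun s => stag _ _ _ s ^+ 2).
set U := bsum _ _ _ (fun s => magn _ s ^+ 2); set Q := bsum _ _ _ _.
clearbody Z V U Q; move=> hU hQ hV hL Z0.
have U_le : U <= C * m ^+ 2 * Z.
  by rewrite /C -mulrA [leRHS]mulrAC ler_pdivlMr ?subr_gt0 // mulrC mulrA.
have Q_le : Q <= 14 * m ^+ 3 * (V + U + Z).
  have -> : Q = m * ((1 - (1 - m^-1)) * Q) by field; rewrite gt_eqF.
  have -> : 14 * m ^+ 3 * (V + U + Z) = m * (14 * m ^+ 2 * (V + U + Z)) by ring.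
  by rewrite ler_wpM2l // ltW.
have V0 : 0 <= V.
  have : 0 <= expR 31 * V.
    by apply: le_trans hL; rewrite mulr_ge0 ?sqr_ge0 // ltW.
  by rewrite pmulr_rge0 // expR_gt0.
(* For bounded [m] the scales [N] and [N * m] are comparable, so the diagonal bound suffices. *)
have [mM|Mm] := leP m M.
  apply: (@le_trans _ _ (c2 * (m ^+ 2 * m) * Z)).
    apply: ler_wpM2r; first exact: ltW.
    apply: ler_wpM2r; first by rewrite mulr_ge0 ?sqr_ge0 // ltW.
    by rewrite ge_min lexx orbT.
  have -> : c2 * (m ^+ 2 * m) * Z = m ^+ 2 * Z * m / (expR 31 * M).
    by rewrite /c2; field; rewrite !gt_eqF ?expR_gt0.
  have eM0 : 0 < expR 31 * M by rewrite mulr_gt0 ?expR_gt0.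
  rewrite ler_pdivrMr // [leRHS]mulrA.
  apply: ler_pM => //; first by rewrite mulr_ge0 ?sqr_ge0 // ltW.
    exact: ltW.
  by rewrite (mulrC V).
apply: (@le_trans _ _ (c1 * (m ^+ 2 * m) * Z)).
  apply: ler_wpM2r; first exact: ltW.
  apply: ler_wpM2r; first by rewrite mulr_ge0 ?sqr_ge0 // ltW.
  by rewrite ge_min lexx.
(* Multiplying by [m] turns [(1 - kq) V] into [V], and the bound on [Q] turns the cubic loss into
   [28 (V + U + Z)]. *)
have e1 : m * (m ^+ 2 * Z) <= V + 28 * (V + U + Z) + m * (m ^+ 2 / 4 + 2) * Z
    + 18 / m * V + 2 / m * U.
  have : m * (m ^+ 2 * Z) <= m * ((1 - (1 - m^-1)) * V + 2 / (m ^+ 2) ^+ 2 * Q +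
     (m ^+ 2 / 4 + 2) * Z + 18 / m ^+ 2 * V + 2 / m ^+ 2 * U).
    by rewrite ler_wpM2l // ltW.
  have -> : m * ((1 - (1 - m^-1)) * V + 2 / (m ^+ 2) ^+ 2 * Q +
     (m ^+ 2 / 4 + 2) * Z + 18 / m ^+ 2 * V + 2 / m ^+ 2 * U) =
     V + 2 / m ^+ 3 * Q + m * (m ^+ 2 / 4 + 2) * Z + 18 / m * V + 2 / m * U.
    by field; rewrite gt_eqF.
  have : 2 / m ^+ 3 * Q <= 2 / m ^+ 3 * (14 * m ^+ 3 * (V + U + Z)).
    by rewrite ler_wpM2l // divr_ge0 // exprn_ge0 // ltW.
  have -> : 2 / m ^+ 3 * (14 * m ^+ 3 * (V + U + Z)) = 28 * (V + U + Z).
    by field; rewrite gt_eqF.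
  by move=> h1 h2; lra.
have e2 : 18 / m * V <= 18 * V.
  by rewrite ler_wpM2r // ler_pdivrMr // ler_peMr.
have e3 : 2 / m * U <= 2 * C * m * Z.
  have -> : 2 * C * m * Z = 2 / m * (C * m ^+ 2 * Z) by field; rewrite gt_eqF.
  by rewrite ler_wpM2l // divr_ge0 // ltW.
(* The coefficient of [V] is 47 = 1 + 28 + 18. *)
have e4 : (m ^+ 3 * 3 / 4 - 2 * m - 28 - 28 * C * m ^+ 2 - 2 * C * m) * Z <= 47 * V.
  by have := U_le; lra.
have e5 : m ^+ 3 / 4 <= m ^+ 3 * 3 / 4 - 2 * m - 28 - 28 * C * m ^+ 2 - 2 * C * m.
  have f1 : M * m ^+ 2 <= m ^+ 3.
    by rewrite exprS ler_wpM2r ?sqr_ge0 // ltW.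
  have f2 : m <= m ^+ 2 by rewrite expr2 ler_peMl // ltW.
  have f3 : 1 <= m ^+ 2 by lra.
  have f4 : C * m <= C * m ^+ 2 by rewrite ler_wpM2l //; lra.
  have f5 : 30 * m ^+ 2 <= 30 * C * m ^+ 2 by rewrite ler_wpM2r ?sqr_ge0 //; lra.
  by move: f1; rewrite /M; lra.
have e6 : m ^+ 3 / 4 * Z <= 47 * V.
  by apply: le_trans e4; rewrite ler_wpM2r // ltW.
have -> : c1 * (m ^+ 2 * m) * Z = 47^-1 * (m ^+ 3 / 4 * Z) by rewrite /c1; field.
have -> : V = 47^-1 * (47 * V) by field.
by rewrite ler_wpM2l // invr_ge0.
Qed.

(** * The algorithm and elementary bounds *)

Definition block_score (R : realType) (N n : nat) (x : samples N n) (A : {set 'I_N}) : R :=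
  \sum_k stag R A [set: 'I_N] (x k) ^+ 2.

(** The first half of the sites is the balanced default set that [arg max] requires. *)
Definition max_score_alg (R : realType) : algorithm := fun N n x =>
  [arg max_(A > [set i in take N./2 (enum 'I_N)] | #|A| == N./2) block_score R x A]%O.

Lemma card_first_half N : #|[set i in take N./2 (enum 'I_N)]| == N./2.
Proof.
rewrite cardsE (card_uniqP _) ?take_uniq ?enum_uniq // size_take size_enum_ord.
by case: ltnP => // h; apply/eqP; lia.
Qed.

Lemma max_score_algP (R : realType) N n (x : samples N n) :
  #|max_score_alg R x| = N./2 /\
  forall A : {set 'I_N}, #|A| = N./2 ->
    block_score R x A <= block_score R x (max_score_alg R x).
Proof.
rewrite /max_score_alg; case: arg_maxP => [|A /eqP cA maxA]; first exact: card_first_half.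
by split => // B /eqP; exact: maxA.
Qed.

(** The block signs of [A] and [S] disagree exactly on the symmetric difference. *)
Lemma stag_symdiff (R : realType) N (S A : {set 'I_N}) (s : config N) :
  stag R A [set: 'I_N] s =
  stag R S [set: 'I_N] s - 2 * stag R S [set i | (i \in A) != (i \in S)] s.
Proof.
rewrite !stag_setTE /stag (big_mkcond (fun i => i \in _)) /= mulr_sumr -sumrB.
apply: eq_bigr => i _; rewrite inE.
by case: (i \in A) (i \in S) => -[] /=; rewrite /spin; ring.
Qed.

(** Expansion of the product over subsets; it evaluates the union bound over all error sets at
    once. *)
Lemma sum_pow_card (R : comNzRingType) N (x : R) :
  \sum_(B : {set 'I_N}) x ^+ #|B| = (1 + x) ^+ N.
Proof.
have -> : (1 + x) ^+ N = \prod_(i : 'I_N) (x + 1) by rewrite prodr_const card_ord addrC.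
rewrite bigA_distr; apply: eq_bigr => B _.
by rewrite -big_mkcond /= prodr_const.
Qed.

Lemma expR_le_1D2x (R : realType) (y : R) : 0 <= y <= 2^-1 -> expR y <= 1 + 2 * y.
Proof.
move=> /andP[y0 y1]; have := expR_ge1Dx (- y); rewrite expRN => h.
have e0 := expR_gt0 y; have : (1 - y) * expR y <= 1.
  by rewrite -ler_pdivlMr // mul1r; lra.
have : expR y <= 2 * ((1 - y) * expR y).
  by rewrite mulrA ler_peMl ?expR_ge0 //; lra.
move=> h1 h2; have : y * expR y <= y * 2 by rewrite ler_wpM2l //; lra.
lra.
Qed.

(** * Chernoff and union bounds for the failure probability *)

Section Recovery.
Variables (R : realType) (alpha beta : R) (N n : nat) (S : {set 'I_N}).
Let kp := (alpha + beta) / 2.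
Let kq := (beta - alpha) / 2.
Hypothesis (N_gt0 : (0 < N)%N) (cardS : #|S| = #|~: S|).
Hypothesis (kp01 : 0 <= kp <= 1) (kq01 : 0 <= kq <= 1).
(** [V] is the scale of [v^2]. Tilting the weight by [- theta / V * v^2] lowers [kq] by
    [2 * theta * N / V], the coupling at which the second moment is assumed large. *)
Variables (theta c V : R).
Hypothesis (theta_ge0 : 0 <= theta) (V_gt0 : 0 < V).
Hypothesis second_moment :
  c * V * \sum_s expR (block_energy kp (kq - 2 * theta * N%:R / V) S s) <=
  \sum_s stag R S [set: 'I_N] s ^+ 2 *
     expR (block_energy kp (kq - 2 * theta * N%:R / V) S s).

Let v s := stag R S [set: 'I_N] s.

Lemma sum_gibbs_expR (Y : config N -> R) (b : R) :
  \sum_s expR (block_energy kp kq S s + Y s) <=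
    expR b * \sum_s expR (block_energy kp kq S s) ->
  \sum_s gibbs alpha beta S s * expR (Y s) <= expR b.
Proof.
move=> h; rewrite -(@ler_pM2r _ (\sum_s expR (block_energy kp kq S s))) ?sum_block_energy_gt0 //.
apply: le_trans h; rewrite mulr_suml le_eqVlt; apply/orP; left; apply/eqP.
apply: eq_bigr => s _; rewrite /gibbs hamiltonianE -/kp -/kq.
have -> : \sum_s' expR (- hamiltonian alpha beta S s') =
          \sum_s expR (block_energy kp kq S s).
  by apply: eq_bigr => s' _; rewrite hamiltonianE.
rewrite expRD; field.
by rewrite gt_eqF ?sum_block_energy_gt0.
Qed.

Lemma gibbs_ge0 s : 0 <= gibbs alpha beta S s.
Proof. by rewrite divr_ge0 ?expR_ge0 // sumr_ge0 // => s' _; exact: expR_ge0. Qed.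

Lemma sum_gibbs : \sum_s gibbs alpha beta S s = 1.
Proof.
rewrite -mulr_suml divff // gt_eqF //.
have := sum_block_energy_gt0 kp kq S; under eq_bigr do rewrite -hamiltonianE.
by [].
Qed.

Lemma sum_samples (F : config N -> R) :
  \sum_(x : samples N n) \prod_(k < n) F (x k) = (\sum_s F s) ^+ n.
Proof.
have -> : (\sum_s F s) ^+ n = \prod_(k < n) \sum_s F s.
  by rewrite prodr_const card_ord.
by rewrite bigA_distr_bigA.
Qed.

(** By independence the exponential moment factorizes over the samples. *)
Lemma sum_samples_expR_le (Y : config N -> R) (b : R) :
  \sum_s gibbs alpha beta S s * expR (Y s) <= expR b ->
  \sum_(x : samples N n) (\prod_(k < n) gibbs alpha beta S (x k)) *
     expR (\sum_k Y (x k)) <= expR (b * n%:R).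
Proof.
move=> h.
have -> : \sum_(x : samples N n) (\prod_(k < n) gibbs alpha beta S (x k)) *
     expR (\sum_k Y (x k)) = (\sum_s gibbs alpha beta S s * expR (Y s)) ^+ n.
  by rewrite -sum_samples; apply: eq_bigr => x _; rewrite expR_sum -big_split.
rewrite expRM_natr lerXn2r // ?nnegrE ?expR_ge0 //.
by apply: sumr_ge0 => s _; rewrite mulr_ge0 ?expR_ge0 ?gibbs_ge0.
Qed.

(** With [X = theta c - theta v^2 / V], the second moment at the lowered coupling makes the tilted
    mean of [X] nonpositive, so [E e^X <= 1]. Half of [theta c] is given up as decay rate. *)
Lemma gibbs_stag_tail :
  \sum_s gibbs alpha beta S s * expR (theta * c / 2 - theta / V * v s ^+ 2) <=
  expR (- (theta * c / 2)).
Proof.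
apply: sum_gibbs_expR.
pose X s := theta * c - theta / V * v s ^+ 2.
have EX s : block_energy kp kq S s + X s =
    block_energy kp (kq - 2 * theta * N%:R / V) S s + theta * c.
  rewrite /X /block_energy -/(v s); field.
  by rewrite !gt_eqF // ltr0n.
have : \sum_s expR (block_energy kp kq S s + X s) <=
       \sum_s expR (block_energy kp kq S s).
  apply: sum_expR_tilt_le; under eq_bigr do rewrite EX expRD.
  have -> : \sum_s X s * (expR (block_energy kp (kq - 2 * theta * N%:R / V) S s) *
      expR (theta * c)) = expR (theta * c) * (theta / V) *
    (c * V * (\sum_s expR (block_energy kp (kq - 2 * theta * N%:R / V) S s)) -
     \sum_s v s ^+ 2 * expR (block_energy kp (kq - 2 * theta * N%:R / V) S s)).
    rewrite [in RHS]mulr_sumr -sumrB mulr_sumr; apply: eq_bigr => s _.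
    by rewrite /X; field; rewrite gt_eqF.
  apply: mulr_ge0_le0; last by rewrite subr_le0.
  by rewrite mulr_ge0 ?expR_ge0 // divr_ge0 // ltW.
move=> h; have -> : \sum_s expR (block_energy kp kq S s +
    (theta * c / 2 - theta / V * v s ^+ 2)) =
  expR (- (theta * c / 2)) * \sum_s expR (block_energy kp kq S s + X s).
  rewrite [RHS]mulr_sumr; apply: eq_bigr => s _; rewrite -expRD; congr expR.
  by rewrite /X; field; rewrite gt_eqF.
by rewrite ler_wpM2l ?expR_ge0.
Qed.

(** The error sets of the union bound: nonempty, with equally many sites in both blocks, and
    containing at most half of [S]. *)
Definition admissible (B : {set 'I_N}) :=
  [&& B != finset.set0, #|B :&: S| == #|B :\: S| & (#|B :&: S| <= #|~: B :&: S|)%N].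

Lemma card_admissible B : admissible B -> #|B|%:R = 2 * #|B :&: S|%:R :> R.
Proof.
move=> /and3P[_ /eqP BS _]; rewrite -(cardsID S B) -BS natrD; ring.
Qed.

(** The subtracted constant is what the term [t v^2] of the tilt supplies per sample when the
    average of [v^2] exceeds [c V / 2]. *)
Lemma gibbs_tilt B : admissible B ->
  \sum_s gibbs alpha beta S s *
    expR (tilt kq S B s - tilt_rate kq B S * (c * V / 2)) <=
  expR (- (tilt_rate kq B S * (c * V / 2))).
Proof.
move=> /and3P[_ /eqP BS BBc]; apply: sum_gibbs_expR.
have -> : \sum_s expR (block_energy kp kq S s +
    (tilt kq S B s - tilt_rate kq B S * (c * V / 2))) =
  expR (- (tilt_rate kq B S * (c * V / 2))) *
    \sum_s expR (block_energy kp kq S s + tilt kq S B s).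
  rewrite [RHS]mulr_sumr; apply: eq_bigr => s _; rewrite -expRD; congr expR.
  by ring.
by rewrite ler_wpM2l ?expR_ge0 // sum_tilt_le.
Qed.

Lemma block_score_symdiff (x : samples N n) (A B : {set 'I_N}) :
  B = [set i | (i \in A) != (i \in S)] \/ B = ~: [set i | (i \in A) != (i \in S)] ->
  block_score R x A = block_score R x S -
    4 * \sum_k stag R S B (x k) * stag R S (~: B) (x k).
Proof.
move=> hB; rewrite /block_score mulr_sumr -sumrB; apply: eq_bigr => k _.
rewrite (stag_symdiff R S A); set D := [set i | _] in hB *.
rewrite (stagT R S D).
by case: hB => ->; rewrite ?finset.setCK; ring.
Qed.

(** Equal cardinals of [A] and [S] balance the symmetric difference; if it contains more than half
    of [S], its complement is taken, which leaves the product [w r] unchanged. *)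
Lemma admissible_symdiff (A : {set 'I_N}) : #|A| = #|S| -> A != S -> A != ~: S ->
  exists2 B, admissible B &
  B = [set i | (i \in A) != (i \in S)] \/ B = ~: [set i | (i \in A) != (i \in S)].
Proof.
move=> cA AS ASc; set D := [set i | _].
have D0 : D != finset.set0.
  apply: contraNneq AS => D0; apply/eqP/setP => i.
  have := finset.in_set0 i; rewrite -D0 inE.
  by case: (i \in A) (i \in S) => -[].
have Dc0 : ~: D != finset.set0.
  apply: contraNneq ASc => D0'; apply/eqP/setP => i.
  have := finset.in_set0 i; rewrite -D0' !inE.
  by case: (i \in A) (i \in S) => -[].
have e1 : D :&: S = S :\: A.
  by apply/setP => i; rewrite !inE; case: (i \in A) (i \in S) => -[].
have e2 : D :\: S = A :\: S.
  by apply/setP => i; rewrite !inE; case: (i \in A) (i \in S) => -[].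
have e3 : ~: D :&: S = S :&: A.
  by apply/setP => i; rewrite !inE; case: (i \in A) (i \in S) => -[].
have e4 : ~: D :\: S = ~: S :\: A.
  by apply/setP => i; rewrite !inE; case: (i \in A) (i \in S) => -[].
have c1 := cardsID A S; have c2 := cardsID S A; rewrite finset.setIC in c2.
have c3 := cardsID A (~: S).
have e5 : ~: S :&: A = A :\: S.
  by apply/setP => i; rewrite !inE andbC.
rewrite e5 in c3.
case: (leqP #|D :&: S| #|~: D :&: S|) => h.
  exists D; last by left.
  rewrite /admissible D0 h andbT e1 e2 -(eqn_add2l #|S :&: A|).
  by rewrite c1 c2 cA eqxx.
exists (~: D); last by right.
rewrite /admissible Dc0 finset.setCK (ltnW h) andbT e3 e4.
by rewrite -(eqn_add2l #|A :\: S|) c3 -cardS -cA addnC c2 eqxx.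
Qed.

(** [F] is the factor of [ln (N / delta)] in the sample size. Each error set [B] costs at most
    [xi ^+ #|B|] and a small sum of [v^2] costs [xi], in total at most [3 N xi <= delta]. *)
Lemma failure_le (delta : R) (F : R) :
  (2 <= N)%N -> 0 < delta < 1 -> 0 < c -> #|S| = N./2 ->
  F * V = N%:R ^+ 2 -> 1 <= F ->
  3 * F * ln (N%:R / delta) <= theta * c / 2 * n%:R ->
  3 * F * ln (N%:R / delta) <= kq ^+ 2 * c / (32 * expR 40) * n%:R ->
  sample_prob alpha beta S
    (fun x : samples N n => ~~ exact_recovery S (max_score_alg R x)) <= delta.
Proof.
move=> N2 /andP[d0 d1] c0 cS FV F1 n1 n2.
have NR0 : (0 : R) < N%:R by rewrite ltr0n.
have NR2 : (2 : R) <= N%:R by rewrite ler_nat.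
set L := ln (N%:R / delta) in n1 n2.
have L0 : 0 <= L.
  by rewrite ln_ge0 // ler_pdivlMr // mul1r; lra.
(* The cube makes [N xi = delta^3 / N^2], which is at most [delta / 4] since [N >= 2]. *)
pose xi : R := (delta / N%:R) ^+ 3.
have xiE : expR (- (3 * L)) = xi.
  rewrite expRN expRM_natl lnK ?posrE ?divr_gt0 // /xi.
  by field; rewrite !gt_eqF.
pose Y0 s := theta * c / 2 - theta / V * v s ^+ 2.
pose YB B s := tilt kq S B s - tilt_rate kq B S * (c * V / 2).
pose G (x : samples N n) := \prod_(k < n) gibbs alpha beta S (x k).
have G0 x : 0 <= G x by apply: prodr_ge0 => k _; exact: gibbs_ge0.
have pointwise (x : samples N n) : ~~ exact_recovery S (max_score_alg R x) ->
  1 <= expR (\sum_k Y0 (x k)) + \sum_(B | admissible B) expR (\sum_k YB B (x k)).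
  rewrite /exact_recovery negb_or => /andP[nS nSc].
  have [cA maxA] := max_score_algP R x.
  have [|B aB hB] := admissible_symdiff _ nS nSc; first by rewrite cA cS.
  have := maxA _ cS; rewrite (block_score_symdiff x hB) => hsc.
  have S0 : 0 <= \sum_(B' | admissible B') expR (\sum_k YB B' (x k)).
    by apply: sumr_ge0 => B' _; exact: expR_ge0.
  (* Either the samples have a small sum of [v^2], or the tilt of the failing [B] has a nonnegative
     sum over them. *)
  have [small|big] := leP (\sum_k v (x k) ^+ 2) (n%:R * (c * V / 2)).
    have : 0 <= \sum_k Y0 (x k).
      rewrite /Y0 sumrB sumr_const card_ord -mulr_sumr subr_ge0.
      apply: (@le_trans _ _ (theta / V * (n%:R * (c * V / 2)))).
        by rewrite ler_wpM2l // divr_ge0 // ltW.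
      rewrite -mulr_natl le_eqVlt; apply/orP; left; apply/eqP; field.
      by rewrite gt_eqF.
    by have := expR_ge1Dx (\sum_k Y0 (x k)); lra.
  have t0 : 0 <= tilt_rate kq B S.
    apply: divr_ge0; first by apply: mulr_ge0; rewrite ?sqr_ge0.
    by apply: mulr_ge0; rewrite ?sqr_ge0 // mulr_ge0 ?expR_ge0.
  have YB0 : 0 <= \sum_k YB B (x k).
    rewrite /YB /tilt !sumrB -!mulr_sumr sumr_const card_ord.
    have h1 : 0 <= tilt_rate kq B S * (\sum_k v (x k) ^+ 2 - n%:R * (c * V / 2)).
      by rewrite mulr_ge0 // subr_ge0 ltW.
    have h2 : 0 <= kq / (2 * N%:R) * - \sum_k stag R S B (x k) * stag R S (~: B) (x k).
      apply: mulr_ge0; last by lra.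
      by case/andP: kq01 => kq0 _; apply: divr_ge0 => //; rewrite mulr_ge0.
    by rewrite -[_ *+ n]mulr_natl; move: h1 h2; rewrite /v; lra.
  rewrite (bigD1 B) //=.
  have S1 : 0 <= \sum_(B' | admissible B' && (B' != B)) expR (\sum_k YB B' (x k)).
    by apply: sumr_ge0 => B' _; exact: expR_ge0.
  have := expR_ge1Dx (\sum_k YB B (x k)); have := expR_ge0 (\sum_k Y0 (x k)).
  by lra.
have union : sample_prob alpha beta S
    (fun x : samples N n => ~~ exact_recovery S (max_score_alg R x)) <=
  \sum_x G x * expR (\sum_k Y0 (x k)) +
  \sum_(B | admissible B) \sum_x G x * expR (\sum_k YB B (x k)).
  rewrite exchange_big -big_split /= /sample_prob [leLHS]big_mkcond /=.
  apply: ler_sum => x _; rewrite -mulr_sumr -mulrDr -/(G x).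
  case: ifP => [/pointwise h|_]; first by rewrite ler_peMr.
  by rewrite mulr_ge0 // addr_ge0 ?expR_ge0 // sumr_ge0 // => B _; exact: expR_ge0.
have b1 : \sum_x G x * expR (\sum_k Y0 (x k)) <= xi.
  apply: le_trans (sum_samples_expR_le gibbs_stag_tail) _.
  rewrite -xiE ler_expR mulNr lerN2; apply: le_trans n1.
  by rewrite mulrAC ler_peMr // mulr_ge0.
have b2 B : admissible B -> \sum_x G x * expR (\sum_k YB B (x k)) <= xi ^+ #|B|.
  move=> aB; apply: le_trans (sum_samples_expR_le (gibbs_tilt aB)) _.
  rewrite -xiE -expRM_natr ler_expR !mulNr lerN2.
  (* The rate is proportional to [#|B|], and [V / N^2 = 1 / F]; the constant 32 is [8 * 2] times 2
     from [#|B| = 2 #|B :&: S|]. *)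
  have -> : tilt_rate kq B S * (c * V / 2) * n%:R =
    #|B|%:R / F * (kq ^+ 2 * c / (32 * expR 40) * n%:R).
    rewrite (card_admissible aB) /tilt_rate -FV.
    have F0 : F != 0 by rewrite gt_eqF //; lra.
    by field; rewrite F0 !gt_eqF ?expR_gt0.
  have -> : 3 * L * #|B|%:R = #|B|%:R / F * (3 * F * L).
    by field; rewrite gt_eqF //; lra.
  by rewrite ler_wpM2l // divr_ge0 //; lra.
have xi0 : 0 <= xi by rewrite exprn_ge0 // divr_ge0 // ltW.
have b3 : \sum_(B | admissible B) xi ^+ #|B| <= (1 + xi) ^+ N - 1.
  rewrite -sum_pow_card [in leRHS](bigD1 finset.set0) //= cards0 expr0 addrC addrK.
  rewrite [leRHS](bigID admissible) /= -[leLHS]addr0 lerD //.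
    rewrite le_eqVlt; apply/orP; left; apply/eqP; apply: eq_bigl => B.
    by rewrite /admissible; case: (B == finset.set0).
  by apply: sumr_ge0 => B _; rewrite exprn_ge0.
have NxiE : N%:R * xi = delta ^+ 3 / N%:R ^+ 2 by rewrite /xi; field; rewrite gt_eqF.
have d3 : delta ^+ 3 <= delta.
  rewrite exprS; apply: ler_piMr; first exact: ltW.
  by apply: exprn_ile1; exact: ltW.
have Nxi : N%:R * xi <= delta / 4.
  rewrite NxiE ler_pdivrMr ?exprn_gt0 //.
  have : 4 <= N%:R ^+ 2 :> R by rewrite -[4]/(4%:R) (_ : 4%:R = 2 ^+ 2 :> R) ?ler_sqr ?nnegrE //; ring.
  move=> h; have : delta / 4 * 4 <= delta / 4 * N%:R ^+ 2 by rewrite ler_wpM2l //; lra.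
  by lra.
have b4 : (1 + xi) ^+ N <= 1 + 2 * (N%:R * xi).
  apply: le_trans (expR_le_1D2x _); last by rewrite mulr_ge0 //; apply/andP; split => //; lra.
  rewrite mulrC expRM_natr lerXn2r ?nnegrE ?expR_ge0 ?addr_ge0 //.
  exact: expR_ge1Dx.
have b5 : \sum_(B | admissible B) \sum_x G x * expR (\sum_k YB B (x k)) <=
          \sum_(B | admissible B) xi ^+ #|B| by apply: ler_sum => B; exact: b2.
have b6 : xi <= N%:R * xi by rewrite ler_peMl //; lra.
by lra.
Qed.

End Recovery.

(** * From second moments to recovery, and the two regimes *)

Lemma recovers_max_score (R : realType) (alpha beta theta c : R) (V f : nat -> R) :
  0 <= (alpha + beta) / 2 <= 1 -> 0 < (beta - alpha) / 2 <= 1 -> 0 < theta -> 0 < c ->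
  (forall N, (0 < N)%N -> [/\ 0 < V N, 1 <= f N & f N * V N = N%:R ^+ 2]) ->
  (forall N (S : {set 'I_N}), (0 < N)%N -> #|S| = #|~: S| ->
    c * V N * \sum_s expR (block_energy ((alpha + beta) / 2)
                 ((beta - alpha) / 2 - 2 * theta * N%:R / V N) S s) <=
    \sum_s stag R S [set: 'I_N] s ^+ 2 * expR (block_energy ((alpha + beta) / 2)
                 ((beta - alpha) / 2 - 2 * theta * N%:R / V N) S s)) ->
  exists C : R, 0 < C /\ exists alg : algorithm,
    valid_algorithm alg /\ recovers_with alpha beta alg C f.
Proof.
move=> kp01 /andP[kq0 kq1] th0 c0 Vf moment.
have kq01 : 0 <= (beta - alpha) / 2 <= 1 by rewrite ltW.
pose r1 := theta * c / 2; pose r2 := ((beta - alpha) / 2) ^+ 2 * c / (32 * expR 40).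
have r10 : 0 < r1 by rewrite divr_gt0 // mulr_gt0.
have r20 : 0 < r2.
  by apply: divr_gt0; apply: mulr_gt0 => //; rewrite ?exprn_gt0 ?expR_gt0.
(* The sum of the two constants meets both sample size conditions of [failure_le]. *)
exists (3 / r1 + 3 / r2); split; first by rewrite addr_gt0 // divr_gt0.
exists (max_score_alg R); split => [N n x _|N S n delta evN cS d0 hn].
  by case: (max_score_algP R x).
have gibbs_pos s : 0 <= gibbs alpha beta S s by exact: gibbs_ge0.
have [d1|d1] := leP 1 delta.
  apply: (@le_trans _ _ 0); first by rewrite subr_le0.
  by apply: sumr_ge0 => x _; apply: prodr_ge0 => k _.
have total : sample_prob alpha beta S
      (fun x : samples N n => exact_recovery S (max_score_alg R x)) +
    sample_prob alpha beta S
      (fun x : samples N n => ~~ exact_recovery S (max_score_alg R x)) = 1.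
  rewrite /sample_prob -(bigID (fun x : samples N n => exact_recovery S _) predT) /=.
  by rewrite sum_samples sum_gibbs expr1n.
suff : sample_prob alpha beta S
  (fun x : samples N n => ~~ exact_recovery S (max_score_alg R x)) <= delta by lra.
(* Without sites all sets coincide, so recovery is automatic. *)
case: (posnP N) => [N0|N0].
  rewrite /sample_prob big_pred0 ?ltW // => x.
  apply/negbTE; rewrite negbK /exact_recovery; apply/orP; left; apply/eqP/setP => i.
  by have := ltn_ord i; rewrite {2}N0.
have N2 : (2 <= N)%N by case: N N0 evN {S cS hn total gibbs_pos} => [|[]].
have cSc : #|S| = #|~: S|.
  by apply/eqP; rewrite -(eqn_add2l #|S|) cardsC card_ord cS addnn -[X in _ == X]odd_double_half
    (negPf evN).
have [V0 f1 fV] := Vf N N0.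
have L0 : 0 <= ln (N%:R / delta).
  have : (2 : R) <= N%:R by rewrite ler_nat.
  by move=> h; rewrite ln_ge0 // ler_pdivlMr // mul1r; lra.
have fL0 : 0 <= f N * ln (N%:R / delta) by rewrite mulr_ge0 //; lra.
have rate r r' : 0 < r -> 0 <= r' -> (3 / r + r') * (f N * ln (N%:R / delta)) <= n%:R ->
    3 * f N * ln (N%:R / delta) <= r * n%:R.
  move=> r0 r'0 h; rewrite -mulrA; set T := f N * _ in fL0 h *.
  have -> : 3 * T = r * (3 / r * T) by field; rewrite gt_eqF.
  rewrite ler_wpM2l ?(ltW r0) //; apply: le_trans h.
  by rewrite ler_wpM2r // lerDl.
apply: (@failure_le R alpha beta N n S N0 cSc kp01 kq01 theta c (V N) (ltW th0) V0 (moment N S N0 cSc)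
  delta (f N)) => //.
- by rewrite d0.
- apply: (@rate r1 (3 / r2)) => //; first by rewrite divr_ge0 // (ltW r20).
  by rewrite mulrA.
- apply: (@rate r2 (3 / r1)) => //; first by rewrite divr_ge0 // (ltW r10).
  by rewrite addrC mulrA.
Qed.

Theorem theorem1p3 (R : realType) (alpha beta : R) :
  0 < beta -> `|alpha| <= beta -> alpha < beta -> alpha != 0 ->
  `|alpha| + beta = 2 ->
  (0 < alpha ->
     exists C3 : R, 0 < C3 /\ exists alg : algorithm,
       valid_algorithm alg /\
       recovers_with alpha beta alg C3 (fun N => N%:R)) /\
  (alpha < 0 ->
     exists C4 : R, 0 < C4 /\ exists alg : algorithm,
       valid_algorithm alg /\
       recovers_with alpha beta alg C4 (fun N => Num.sqrt (N%:R : R))).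
Proof.
move=> beta0 alpha_le ltab _ critical; split => alpha0.
  rewrite gtr0_norm // in alpha_le critical.
  (* Here [kp = 1] and [0 < kq < 1]. With [V = N] this [theta] halves [kq], where the diagonal bound
     still holds, and [N^2 / V = N]. *)
  apply: (@recovers_max_score R alpha beta ((beta - alpha) / 8) (expR (-31))
    (fun N => N%:R)); rewrite ?expR_gt0 //.
  - by apply/andP; split; lra.
  - by apply/andP; split; lra.
  - by lra.
  - by move=> N N0; split; rewrite ?ltr0n ?ler1n // expr2.
  move=> N S N0 cS.
  have -> : (beta - alpha) / 2 - 2 * ((beta - alpha) / 8) * N%:R / N%:R = (beta - alpha) / 4.
    by field; rewrite gt_eqF // ltr0n.
  rewrite expRN -mulrA mulrC ler_pdivrMr ?expR_gt0 // [leRHS]mulrC.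
  by apply: second_moment_ge => //; apply/andP; split; lra.
rewrite ltr0_norm // in alpha_le critical.
have kp01 : 0 <= (alpha + beta) / 2 < 1 by apply/andP; split; lra.
have [c c0 hc] := critical_second_moment_ge kp01.
(* Here [kq = 1] is critical and [kp < 1]. With [V = N * sqrt N] this [theta] lowers [kq] to
   [1 - 1 / sqrt N], and [N^2 / V = sqrt N]. *)
apply: (@recovers_max_score R alpha beta 2^-1 c
  (fun N => N%:R * Num.sqrt N%:R)) => //.
- by case/andP: kp01 => -> /ltW.
- by apply/andP; split; lra.
- move=> N N0; have s0 : 0 < Num.sqrt N%:R :> R by rewrite sqrtr_gt0 ltr0n.
  have sN : Num.sqrt N%:R ^+ 2 = N%:R :> R by rewrite sqr_sqrtr.
  split; first by rewrite mulr_gt0 ?ltr0n.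
    by rewrite -[leLHS]sqrtr1 ler_wsqrtr // ler1n.
  by rewrite mulrCA -expr2 sN expr2.
move=> N S N0 cS.
have s0 : 0 < Num.sqrt N%:R :> R by rewrite sqrtr_gt0 ltr0n.
have -> : (beta - alpha) / 2 - 2 * 2^-1 * N%:R / (N%:R * Num.sqrt N%:R) =
          1 - (Num.sqrt N%:R)^-1.
  have -> : (beta - alpha) / 2 = 1 by lra.
  by field; rewrite !gt_eqF // ltr0n.
exact: hc.
Qed.
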